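(* Let $n$ and $k$ be integers with $\lfloor n/2\rfloor+1\le k\le n-1$. For every $G\in G(n,k)$, $$\rho(G)\le\rho(\mathcal G(n,k)),$$ with equality if and only if $G\cong\mathcal G(n,k)$.
   Context: A clique tree is a connected graph each of whose blocks (maximal connected subgraphs without a cut vertex of their own) is a complete graph. $Z(\cdot)$ is the zero forcing number: with vertices coloured blue or white, a blue vertex with exactly one white neighbour turns that neighbour blue; $Z(G)$ is the minimum size of an initially blue set from which all vertices eventually become blue. $G(n,k)$ is the class of clique trees on $n$ vertices with zero forcing number $k$ in which every block has at least $3$ vertices. $\mathcal G(n,k)$ is the clique tree consisting of one copy of $K_{2k-n+2}$ and $n-k-1$ copies of $K_3$, all sharing a single common vertex (and otherwise disjoint); it lies in $G(n,k)$. $\rho(\cdot)$ is the spectral radius of the adjacency matrix. *)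

(* Defs.v *)
From HB Require Import structures.
From mathcomp Require Import all_boot all_order all_algebra algC.
Set Implicit Arguments. Unset Strict Implicit. Unset Printing Implicit Defensive.
Import Order.TTheory GRing.Theory Num.Theory.

Definition simple_graph (T : finType) (e : rel T) : Prop :=
  symmetric e /\ irreflexive e.

Section Graphs.
Variables (T : finType) (e : rel T).

Definition induced_rel (S : {set T}) : rel T :=
  [rel x y | [&& e x y, x \in S & y \in S]].

(* the induced subgraph on S is connected (vacuous for S = set0) *)
Definition connected_in (S : {set T}) : bool :=
  [forall x in S, forall y in S, connect (induced_rel S) x y].

Definition connected_graph : bool := connected_in [set: T].

Definition nonseparable (S : {set T}) : bool :=
  connected_in S && [forall v in S, connected_in (S :\ v)].

Definition is_block (B : {set T}) : bool := maxset nonseparable B.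

Definition is_clique (S : {set T}) : bool :=
  [forall x in S, forall y in S, (x != y) ==> e x y].

Definition clique_tree : bool :=
  connected_graph && [forall B : {set T}, is_block B ==> is_clique B].

Definition blocks_ge3 : bool :=
  [forall B : {set T}, is_block B ==> (2 < #|B|)].

(* one (parallel) round of the zero forcing colour-change rule:
   a blue vertex u with exactly one white neighbour w turns w blue *)
Definition force_step (S : {set T}) : {set T} :=
  S :|: [set w | [exists u in S,
           [&& e u w, w \notin S &
               [forall w', (e u w' && (w' \notin S)) ==> (w' == w)]]]].

(* the final blue set; the step is inflationary so #|T| rounds suffice *)
Definition force_closure (S : {set T}) : {set T} := iter #|T| force_step S.

Definition zero_forcing_set (S : {set T}) : bool :=
  force_closure S == [set: T].

(* zero forcing number: minimum size of a zero forcing set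
   ([set: T] is always one, so #|T| is a safe default) *)
Definition zero_forcing_number : nat :=
  \big[minn/#|T|]_(S : {set T} | zero_forcing_set S) #|S|.

Definition adj_matrix : 'M[algC]_#|T| :=
  \matrix_(i, j) ((e (enum_val i) (enum_val j) : nat)%:R)%R.

End Graphs.

(* spectral radius: max modulus of the (complex) eigenvalues, i.e. of the
   roots (with multiplicity) of the characteristic polynomial *)
Definition spectral_radius (m : nat) (A : 'M[algC]_m) : algC :=
  (\big[Num.max/0]_(z <- sval (closed_field_poly_normal (char_poly A))) `|z|)%R.

Definition graph_spectral_radius (T : finType) (e : rel T) : algC :=
  spectral_radius (adj_matrix e).

(* The extremal graph \mathcal G(n,k) on vertex set 'I_n:
   vertex 0 is the common vertex; vertices 1..m, m := 2k-n+1, complete the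
   copy of K_{2k-n+2}; the remaining 2(n-k-1) vertices m+1,...,n-1 are
   grouped in consecutive pairs, each pair forming a K_3 with vertex 0. *)
Definition extremal_rel (n k : nat) : rel 'I_n :=
  fun i j =>
    let m := (2 * k - n + 1)%N in
    (i != j) &&
    [|| (i == 0 :> nat), (j == 0 :> nat),
        (i <= m) && (j <= m) |
        [&& m < i, m < j & (i - m - 1) %/ 2 == (j - m - 1) %/ 2]].

Definition graph_iso (T1 T2 : finType) (e1 : rel T1) (e2 : rel T2) : Prop :=
  exists f : T1 -> T2, bijective f /\ forall x y, e2 (f x) (f y) = e1 x y.
Arguments extremal_rel n k : clear implicits.

(* Main.v *)
Require Import Defs.
From HB Require Import structures.
From mathcomp Require Import all_boot all_order all_algebra algC.
From mathcomp Require Import zify ring lra.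
Set Implicit Arguments. Unset Strict Implicit. Unset Printing Implicit Defensive.
Import Order.TTheory GRing.Theory Num.Theory.

(* Let b be the number of blocks of G.  Every force completes a new block, so
   Z(G) >= n - b, that is b >= n - k.

   Write lam = w - 1.  The inequality rho(G) <= lam follows once every flag
   (v, B), v in B, carries a weight q(v, B) < w such that the sum over v in B of
   1 / (w - q(v, B)) is at most 1 (by Cauchy-Schwarz this bounds the quadratic
   form of the clique B by sum (lam - q(v, B)) x_v^2) and such that, for each v,
   the numbers lam - q(v, B) sum to at most lam.  Root G at a block.  A branch
   with b' blocks and total excess e' (the excess of a block C is |C| - 3) gets the
   demand [demand w b' e'], the weight that it would need at its root if all its
   blocks were attached there and one of them had all the excess.  If v is on the
   far side of B, let q(v, B) be the demand of the branch hanging at v; if v is the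
   vertex of B nearest to the root, let lam - q(v, B) be the demand of the branch
   starting with B.  Superadditivity of the demand and convexity of
   t -> 1 / (w - t) give both conditions as soon as demand w b e <= lam for the
   totals b, e of G.  For the extremal graph, whose spectral radius is read off an
   explicit positive eigenvector, this is an equality; with n fixed, more blocks
   only lower the demand.

   If rho(G) = lam, then for every choice of the root block the estimates are
   tight: at most one vertex of the root block lies in another block, and the
   excess is concentrated either in the root block or outside it.  Hence all
   blocks share a vertex and at most one of them is not a triangle. *)

(** * Blocks *)

Section Blocks.
Variables (T : finType) (e : rel T).
Hypothesis sym_e : symmetric e.

Lemma connected_inP (S : {set T}) :
  reflect {in S &, forall x y, connect (induced_rel e S) x y} (connected_in e S).
Proof.
apply: (iffP forall_inP) => [conS x y xS yS|conS x xS].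
  by have /forall_inP := conS x xS; apply.
by apply/forall_inP => y yS; exact: conS.
Qed.

Lemma induced_connect_sym (S : {set T}) : connect_sym (induced_rel e S).
Proof.
apply: sym_connect_sym => x y.
by rewrite /induced_rel /= sym_e (andbC (y \in S)).
Qed.

Lemma induced_connect_sub (A B : {set T}) x y : A \subset B ->
  connect (induced_rel e A) x y -> connect (induced_rel e B) x y.
Proof.
move=> /subsetP AB; apply: connect_sub => {x y} x y /and3P[exy xA yA].
by apply: connect1; rewrite /induced_rel /= exy !AB.
Qed.

Lemma connected_inU (A B : {set T}) z : z \in A -> z \in B ->
  connected_in e A -> connected_in e B -> connected_in e (A :|: B).
Proof.
move=> zA zB /connected_inP conA /connected_inP conB.
have toz x : x \in A :|: B -> connect (induced_rel e (A :|: B)) x z.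
  rewrite inE => /orP[xA|xB].
    by apply: (induced_connect_sub (subsetUl A B)); apply: conA.
  by apply: (induced_connect_sub (subsetUr A B)); apply: conB.
apply/connected_inP => x y /toz xz /toz yz; apply: connect_trans xz _.
by rewrite induced_connect_sym.
Qed.

Lemma connected_in1 x : connected_in e [set x].
Proof. by apply/connected_inP => y z /set1P-> /set1P->. Qed.

Lemma connected_in0 : connected_in e set0.
Proof. by apply/connected_inP => y z; rewrite inE. Qed.

Lemma connected_in2 x y : e x y -> connected_in e [set x; y].
Proof.
move=> exy; apply/connected_inP => u v; rewrite !inE.
have c1 : connect (induced_rel e [set x; y]) x y.
  by apply: connect1; rewrite /induced_rel /= exy !inE !eqxx orbT.
by move=> /orP[]/eqP-> /orP[]/eqP-> //; rewrite ?connect0 // induced_connect_sym.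
Qed.

Lemma connected_path x p : path e x p -> connected_in e [set z in x :: p].
Proof.
elim: p x => [|y p IHp] x /=.
  rewrite (_ : [set z in _] = [set x]) ?connected_in1 //.
  by apply/setP => z; rewrite !inE.
move=> /andP[exy /IHp con_p].
have -> : [set z in [:: x, y & p]] = [set x; y] :|: [set z in y :: p].
  by apply/setP => z; rewrite !inE; case: (z == y); rewrite ?orbT ?orbF.
by apply: (@connected_inU _ _ y); rewrite ?inE ?eqxx ?orbT ?connected_in2.
Qed.

(** Deleting a vertex turns the cycle into a path; rotating brings the deleted vertex to the
    front. *)
Lemma cycle_nonseparable (c : seq T) : cycle e c -> uniq c ->
  nonseparable e [set z in c].
Proof.
move=> cyc_c uniq_c; apply/andP; split.
  case: c cyc_c {uniq_c} => [_|x p].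
    exact: connected_in0.
  by rewrite /= rcons_path => /andP[/connected_path].
apply/forall_inP => x; rewrite inE => /rot_to[i p rot_c].
have : cycle e (x :: p) by rewrite -rot_c rot_cycle.
have : uniq (x :: p) by rewrite -rot_c rot_uniq.
have -> : [set z in c] = [set z in x :: p].
  by apply/setP => z; rewrite !in_set -rot_c mem_rot.
rewrite /= rcons_path => /andP[xp _] /andP[path_p _].
have -> : [set z in x :: p] :\ x = [set z in p].
  by apply/setP => z; rewrite !inE; case: eqP => //= ->; rewrite (negPf xp).
case: p path_p {rot_c xp} => [_|y p /= /andP[_ /connected_path]] //.
exact: connected_in0.
Qed.

Lemma nonseparable_sub_block (S : {set T}) : nonseparable e S ->
  exists2 B, is_block e B & S \subset B.
Proof. by move=> /maxset_exists[B]; exists B. Qed.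

Lemma edge_in_block x y : e x y ->
  exists2 B, is_block e B & (x \in B) && (y \in B).
Proof.
move=> exy; have [|B blockB sB] := @nonseparable_sub_block [set x; y].
  apply/andP; split; first exact: connected_in2.
  apply/forall_inP => z; rewrite !inE => /orP[]/eqP->.
    have [->|nxy] := eqVneq x y.
      by rewrite setUid setDv connected_in0.
    by rewrite setU1K ?connected_in1 // inE.
  have [->|nxy] := eqVneq x y; first by rewrite setUid setDv connected_in0.
  by rewrite setUC setU1K ?connected_in1 // inE eq_sym.
by exists B => //; rewrite !(subsetP sB) // !inE eqxx ?orbT.
Qed.

(** After the deletion of any vertex, [x] or [y] still joins what is left of [B] and [C]. Their
    union is thus nonseparable, and maximality makes it equal to both. *)
Lemma block_meet (B C : {set T}) x y : is_block e B -> is_block e C ->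
  x \in B -> x \in C -> y \in B -> y \in C -> x != y -> B = C.
Proof.
move=> /maxsetP[nsB maxB] /maxsetP[nsC maxC] xB xC yB yC neq_xy.
have /andP[conB /forall_inP conB'] := nsB.
have /andP[conC /forall_inP conC'] := nsC.
have conD (D : {set T}) z : nonseparable e D -> connected_in e (D :\ z).
  move=> /andP[conD /forall_inP conD']; have [/conD' //|zD] := boolP (z \in D).
  by rewrite (setDidPl _) // disjoint_sym disjoints1.
have nsBC : nonseparable e (B :|: C).
  apply/andP; split; first exact: (@connected_inU _ _ x).
  apply/forall_inP => z _; rewrite setDUl.
  have [zx|zx] := eqVneq z x.
    by apply: (@connected_inU _ _ y); rewrite ?conD // !inE ?yB ?yC zx eq_sym neq_xy.
  by apply: (@connected_inU _ _ x); rewrite ?conD // !inE ?xB ?xC eq_sym zx.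
by rewrite -(maxB _ nsBC (subsetUl _ _)) (maxC _ nsBC (subsetUr _ _)).
Qed.

(** A simple path from [x] to [u] inside [U], closed up through [y], is a cycle, and a cycle lies in
    one block. *)
Lemma detour_in_block (U : {set T}) x u y : connected_in e U ->
    x \in U -> u \in U -> y \notin U -> x != u -> e y x -> e y u ->
  exists2 B, is_block e B & [&& x \in B, u \in B & y \in B].
Proof.
move=> /connected_inP/(_ x u) conU xU uU yU neq_xu eyx eyu.
have /connectP[p0 path_p0 u_last] := conU xU uU.
case/shortenP: path_p0 u_last => p path_p uniq_p _ u_last.
have pU : {subset p <= U}.
  elim: p x path_p {xU neq_xu eyx uniq_p u_last conU} => //= z p IHp x /andP[].
  by move=> /and3P[_ _ zU] /IHp sub_p v; rewrite inE => /orP[/eqP->|/sub_p].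
have path_e : path e x p.
  by apply: sub_path path_p => a b /and3P[].
have cyc : cycle e [:: y, x & p].
  by rewrite /= eyx rcons_path path_e -u_last sym_e.
have uniq_c : uniq [:: y, x & p].
  rewrite /= -/(uniq (x :: p)) uniq_p andbT; apply: contra yU.
  by rewrite inE => /orP[/eqP->|/pU].
have [B blockB /subsetP sB] := nonseparable_sub_block (cycle_nonseparable cyc uniq_c).
exists B => //; apply/and3P; split; apply: sB; rewrite !inE ?eqxx ?orbT //.
by rewrite u_last -in_cons mem_last orbT.
Qed.

End Blocks.

(** * Building a clique tree block by block, and zero forcing *)

Section Connected.
Variables (T : finType) (e : rel T).

Lemma connected_closed (P : pred T) x y : connected_graph e ->
  (forall u v, e u v -> P u -> P v) -> P x -> P y.
Proof.
move=> /connected_inP/(_ x y) con closedP.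
have /connectP[p path_p ->] := con (in_setT _) (in_setT _).
elim: p x path_p {con} => //= z p IHp x /andP[/and3P[exz _ _] path_p] Px.
by apply: IHp path_p (closedP _ _ exz Px).
Qed.
End Connected.

(** * Families of sets attached along single vertices *)

Section TreeSeq.
Variable T : finType.

(* [tree_seq U L]: the sets in [L] are attached one after the other to [U], each
   along a single vertex of what has been built so far. *)
Fixpoint tree_seq (U : {set T}) (L : seq {set T}) : bool :=
  if L is B :: L' then (#|B :&: U| == 1)%N && tree_seq (U :|: B) L' else true.

Definition excess (L : seq {set T}) : nat := (\sum_(B <- L) (#|B| - 3))%N.

Lemma tree_seq_card (U : {set T}) (L : seq {set T}) : tree_seq U L ->
    (forall v, v \in U \/ exists2 B, B \in L & v \in B) ->
  #|U| + \sum_(B <- L) (#|B| - 1) = #|T|.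
Proof.
elim: L U => [|B L IHL] U /=.
  move=> _ covT; rewrite big_nil addn0 -cardsT; congr #|pred_of_set _|.
  by apply/setP => v; rewrite inE; case: (covT v) => [->|[]].
move=> /andP[/eqP BU treeL] covT; rewrite big_cons addnA -(IHL _ treeL).
  congr (_ + _); have := cardsUI U B; rewrite (setIC U) BU.
  have := subset_leq_card (subsetIl B U); rewrite BU; lia.
move=> v; rewrite inE; case: (covT v) => [->|[C]]; first by left.
rewrite inE => /orP[/eqP->|CL] vC; first by left; rewrite vC orbT.
by right; exists C.
Qed.
End TreeSeq.

Section BlockOrder.
Variables (T : finType) (e : rel T).
Hypotheses (sym_e : symmetric e) (tree_e : clique_tree e).

Let con_e : connected_graph e. Proof. by case/andP: tree_e. Qed.

Lemma block_clique B x y : is_block e B -> x \in B -> y \in B -> x != y -> e x y.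
Proof.
move=> blockB xB yB neq_xy; case/andP: tree_e => _ /forallP/(_ B).
by rewrite blockB => /forall_inP/(_ x xB)/forall_inP/(_ y yB)/implyP; apply.
Qed.

(** Induction on the complement of [U]. An edge leaving [U] lies in a block [B], which by the
    closure hypothesis meets [U] in one vertex only; [U :|: B] is again connected and closed. *)
Lemma block_order_from (U : {set T}) :
    U != set0 -> connected_in e U ->
    (forall B x y, is_block e B -> x \in B -> y \in B -> x \in U -> y \in U ->
       x != y -> B \subset U) ->
  exists L, [/\ tree_seq U L, forall B, B \in L -> is_block e B,
    forall v, v \in U \/ exists2 B, B \in L & v \in B
    & forall B, is_block e B -> 1 < #|B| -> B \subset U \/ B \in L].
Proof.
have [k] := ubnP #|~: U|; elim: k U => // k IHk U leUk U0 conU closedU.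
have [UT|UT] := boolP [forall u in U, forall v, e u v ==> (v \in U)].
  have covU v : v \in U.
    case/set0Pn: U0 => u uU; apply: (@connected_closed _ e (mem U) u) => // a b eab aU.
    by have /forall_inP/(_ a aU)/forallP/(_ b)/implyP := UT; apply.
  exists [::]; split=> // [v|B _ _]; first by left.
  by left; apply/subsetP => v _.
have [u uU [y euy yU]] : exists2 u, u \in U & exists2 y, e u y & y \notin U.
  move: UT; rewrite negb_forall_in => /exists_inP[u uU].
  rewrite negb_forall => /existsP[y]; rewrite negb_imply => /andP[? ?].
  by exists u => //; exists y.
have [B blockB /andP[uB yB]] := edge_in_block sym_e euy.
have BU v : v \in B -> v \in U -> v = u.
  move=> vB vU; apply/eqP; apply: contraNT yU => neq_vu.
  by apply: (subsetP (closedU B v u _ _ _ _ _ _)).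
have BUu : B :&: U = [set u].
  apply/setP => v; rewrite !inE; apply/andP/eqP => [[vB vU]|->] //; exact: BU.
have conB : connected_in e B by case/maxsetP: blockB => /andP[].
(* Such an edge, with the clique edge between [z] and [u], would put [x], [u] and [z] in a common
   block. That block shares [z] and [u] with [B], so it is [B], against [x \notin B]. *)
have no_cross x z : x \in U -> x \notin B -> z \in B -> z \notin U -> ~~ e x z.
  move=> xU xB zB zU; apply/negP => exz.
  have neq_xu : x != u by apply: contraNneq xB => ->.
  have neq_zu : z != u by apply: contraNneq zU => ->.
  have [||C blockC /and3P[xC uC zC]] := detour_in_block sym_e conU xU uU zU neq_xu.
  - by rewrite sym_e.
  - exact: (block_clique blockB zB uB neq_zu).
  have BC : B = C.
    exact: (block_meet sym_e blockB blockC zB zC uB uC neq_zu).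
  by rewrite BC xC in xB.
have cross C x z : is_block e C -> x \in C -> z \in C -> x != z ->
    x \in B -> z \in U :|: B -> C = B \/ C \subset U.
  move=> blockC xC zC neq_xz xB; rewrite inE.
  have [zB _|zB] := boolP (z \in B).
    by left; apply: (block_meet sym_e blockC blockB xC xB zC zB neq_xz).
  rewrite orbF => zU; right.
  have [xU|xU] := boolP (x \in U); first exact: (closedU C x z).
  have := no_cross z x zU zB xB xU; rewrite sym_e.
  by rewrite (block_clique blockC xC zC neq_xz).
have closedU' C x z : is_block e C -> x \in C -> z \in C ->
    x \in U :|: B -> z \in U :|: B -> x != z -> C \subset U :|: B.
  move=> blockC xC zC xUB zUB neq_xz.
  have done' : C = B \/ C \subset U -> C \subset U :|: B.
    by case=> [->|CU]; [exact: subsetUr | apply: subset_trans CU (subsetUl _ _)].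
  move: xUB; rewrite inE => /orP[xU|xB]; last exact/done'/(cross C x z).
  move: (zUB); rewrite inE => /orP[zU|zB].
    by apply: done'; right; apply: (closedU C x z).
  by apply: done'; apply: (cross C z x); rewrite // 1?eq_sym // inE xU.
have [|||| L [treeL blockL covL allL]] := IHk (U :|: B).
- rewrite -ltnS; apply: leq_trans leUk; rewrite ltnS; apply: proper_card.
  rewrite properE setCS subsetUl /= setCS; apply/subsetPn.
  by exists y; rewrite // inE yB orbT.
- by apply/set0Pn; exists u; rewrite inE uU.
- exact: (connected_inU sym_e uU uB).
- exact: closedU'.
exists (B :: L); split=> /=.
- by rewrite BUu cards1 eqxx.
- by move=> C; rewrite inE => /orP[/eqP->|/blockL].
- move=> v; have [|[C CL vC]] := covL v; last first.
    by right; exists C; rewrite // inE CL orbT.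
  rewrite inE => /orP[vU|vB]; first by left.
  by right; exists B; rewrite // mem_head.
move=> C blockC C1; have [CUB|CL] := allL C blockC C1; last first.
  by right; rewrite inE CL orbT.
have [CU|/subsetPn[x xC xU]] := boolP (C \subset U); first by left.
have xB : x \in B by have := subsetP CUB x xC; rewrite inE (negPf xU).
have [z /andP[zC neq_zx]] : exists z, (z \in C) && (z != x).
  move: C1; rewrite (cardD1 x) xC ltnS => /card_gt0P[z]; rewrite !inE => /andP[? ?].
  by exists z; apply/andP.
rewrite eq_sym in neq_zx.
have [->|] := cross C x z blockC xC zC neq_zx xB (subsetP CUB z zC).
  by right; rewrite mem_head.
by move/subsetP/(_ x xC) => xU'; rewrite xU' in xU.
Qed.

(** A single block is a legitimate start, since blocks with two common vertices coincide. *)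
Lemma block_order (B : {set T}) : is_block e B -> B != set0 ->
  exists L, [/\ tree_seq B L, forall C, C \in L -> is_block e C,
    forall v, v \in B \/ exists2 C, C \in L & v \in C
    & forall C, is_block e C -> 1 < #|C| -> C \in B :: L].
Proof.
move=> blockB B0; have conB : connected_in e B by case/maxsetP: blockB => /andP[].
have [|L [treeL blockL covL allL]] := block_order_from B0 conB.
  move=> C x y blockC xC yC xB yB neq_xy.
  by rewrite (block_meet sym_e blockC blockB xC xB yC yB neq_xy).
exists L; split=> // C blockC C1; rewrite inE.
have [CB|->] := allL C blockC C1; last by rewrite orbT.
case/maxsetP: blockC => _ maxC; rewrite (maxC B) ?eqxx //.
by case/maxsetP: blockB.
Qed.

Definition full_blocks (S : {set T}) : {set {set T}} :=
  [set B | is_block e B & B \subset S].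

(* When [u] forces [w], the block containing [uw] becomes entirely blue, its
   only white vertex having been [w]: each force uses up its own block. *)
Lemma force_step_full (S : {set T}) :
  #|force_step e S| + #|full_blocks S| <= #|S| + #|full_blocks (force_step e S)|.
Proof.
set S' := force_step e S.
have SS' : S \subset S' by exact: subsetUl.
have forced w : w \in S' :\: S ->
    exists B, [&& is_block e B, B \subset S' & B :\: S == [set w]].
  rewrite !inE => /andP[wS]; rewrite (negPf wS) /= => /exists_inP[u uS].
  move=> /andP[euw /forallP white].
  have [B blockB /andP[uB wB]] := edge_in_block sym_e euw.
  have BS : B :\: S = [set w].
    apply/setP => v; rewrite !inE; apply/andP/eqP => [[vS vB]|->//].
    apply/eqP; have /implyP := white v; apply; rewrite vS andbT.
    by apply: (block_clique blockB uB vB); apply: contraNneq vS => <-.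
  exists B; rewrite blockB BS eqxx andbT /=; apply/subsetP => v vB.
  have [/(subsetP SS') //|vS] := boolP (v \in S).
  have : v \in B :\: S by rewrite inE vS.
  rewrite BS => /set1P->; rewrite !inE; apply/orP; right.
  apply/exists_inP; exists u => //; rewrite euw wS; exact/forallP.
(* The block chosen for a newly forced [w] has [w] as its only vertex outside [S], so the choice is
   injective. The default [set0] does not occur for such [w]. *)
pose blk w := odflt set0 [pick B | [&& is_block e B, B \subset S' & B :\: S == [set w]]].
have blkP w : w \in S' :\: S ->
    [&& is_block e (blk w), blk w \subset S' & blk w :\: S == [set w]].
  move=> /forced[B HB]; rewrite /blk; case: pickP => [//|/(_ B)].
  by rewrite HB.
have inj_blk : {in S' :\: S &, injective blk}.
  move=> v w /blkP/and3P[_ _ /eqP vE] /blkP/and3P[_ _ /eqP wE] eq_vw.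
  by apply/set1P; rewrite -wE -eq_vw vE set11.
have disj : [disjoint full_blocks S & blk @: (S' :\: S)].
  rewrite disjoint_sym disjoints_subset; apply/subsetP => _ /imsetP[w wS ->].
  rewrite !inE; have /and3P[-> _ /eqP wE] := blkP w wS.
  apply/subsetPn; exists w; last by move: wS; rewrite inE => /andP[].
  by have := set11 w; rewrite -wE inE => /andP[].
have sub : full_blocks S :|: blk @: (S' :\: S) \subset full_blocks S'.
  apply/subsetP => B; rewrite inE => /orP[|/imsetP[w /blkP/and3P[bB sB _] ->]].
    by rewrite !inE => /andP[-> BS]; apply: subset_trans BS SS'.
  by rewrite inE bB.
have := subset_leq_card sub; rewrite cardsU disjoint_setI0 // cards0 subn0.
rewrite card_in_imset //; have := cardsID S S'; rewrite (setIidPr SS'); lia.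
Qed.

(** By the one-round inequality, the number of blue vertices minus the number of full blocks never
    increases; at the end every vertex is blue. *)
Lemma zero_forcing_set_card (S : {set T}) : zero_forcing_set e S ->
  #|T| <= #|S| + #|[set B | is_block e B]|.
Proof.
move=> /eqP closS; rewrite -cardsT -closS /force_closure.
have : #|iter #|T| (force_step e) S| + #|full_blocks S| <=
    #|S| + #|full_blocks (iter #|T| (force_step e) S)|.
  elim: #|T| => //= n IHn.
  have := force_step_full (iter n (force_step e) S).
  move: IHn; move: (iter n _ S) => X.
  move: #|X| #|full_blocks X| #|force_step e X| #|full_blocks (force_step e X)|.
  lia.
have sub : #|full_blocks (iter #|T| (force_step e) S)| <= #|[set B | is_block e B]|.
  by apply/subset_leq_card/subsetP => B; rewrite !inE => /andP[].
by lia.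
Qed.

Lemma zero_forcing_number_blocks :
  #|T| <= zero_forcing_number e + #|[set B | is_block e B]|.
Proof.
rewrite /zero_forcing_number.
(* The default [#|T|] of the minimum satisfies the bound trivially. *)
apply: (big_ind (fun m => #|T| <= m + _)) => [|m1 m2|S].
- exact: leq_addr.
- by move=> *; rewrite /minn; case: ifP.
exact: zero_forcing_set_card.
Qed.

End BlockOrder.

(** * Windmills of triangles around one clique *)

Section StarIso.
Variables (T : finType) (e : rel T) (n k m : nat) (c : T) (B : {set T}) (L : seq {set T}).
Hypotheses (mE : m = 2 * k - n + 1) (nE : n = m + 1 + 2 * size L) (cardT : #|T| = n).
Hypotheses (cardB : #|B| = m.+1) (cardL : forall C, C \in L -> #|C| = 3).
Hypothesis center : forall C, C \in B :: L -> c \in C.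
Hypothesis meet : forall C D x, C \in B :: L -> D \in B :: L ->
  x \in C -> x \in D -> x != c -> C = D.
Hypothesis edgeP : forall x y,
  reflect (x != y /\ exists2 C, C \in B :: L & (x \in C) && (y \in C)) (e x y).
Hypothesis cover : forall x, exists2 C, C \in B :: L & x \in C.

(** The labels copy the numbering of [extremal_rel]: 0 for the centre, 1 to [m] for the rest of [B],
    then [m + 1 + 2 * i] and [m + 2 + 2 * i] for the two outer vertices of triangle [i], counted
    from 0. *)
Let petal x := find (fun C : {set T} => x \in C) L.
Let block x := nth B L (petal x).
Let label x :=
  if x == c then 0 else
  if x \in B then (index x (enum (B :\ c))).+1
  else m + 1 + 2 * petal x + index x (enum (block x :\ c)).

Let petalP x : x \notin B ->
  [/\ petal x < size L, block x \in L & x \in block x].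
Proof.
move=> xB; have hasx : has (fun C : {set T} => x \in C) L.
  have [C] := cover x; rewrite inE => /orP[/eqP->|CL xC]; first by rewrite (negPf xB).
  by apply/hasP; exists C.
have lt_x : petal x < size L by rewrite -has_find.
by split=> //; [exact: mem_nth | exact: (nth_find B hasx)].
Qed.

Let index_lt x (C : {set T}) s : c \in C -> #|C| = s.+1 -> x \in C -> x != c ->
  index x (enum (C :\ c)) < s.
Proof.
move=> cC cardC xC xc; suff <- : size (enum (C :\ c)) = s.
  by rewrite index_mem mem_enum !inE xc.
by rewrite -cardE; move: cardC; rewrite (cardsD1 c) cC => -[].
Qed.

Let labelP x : [\/ x = c /\ label x = 0,
  [/\ x != c, x \in B, 0 < label x <= m & label x = (index x (enum (B :\ c))).+1]
 | [/\ x != c, x \notin B, block x \in L, x \in block x & exists2 i, i < 2 &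
    i = index x (enum (block x :\ c)) /\ label x = m + 1 + 2 * petal x + i]].
Proof.
rewrite /label; have [->|xc] := eqVneq x c; first by constructor 1.
have [xB|xB] := boolP (x \in B).
  constructor 2; split=> //=; apply: index_lt => //; exact/center/mem_head.
have [_ bL xb] := petalP xB; constructor 3; split=> //; eexists; last by split.
by apply: index_lt => //; [apply: center; rewrite inE bL orbT | exact: cardL].
Qed.

Let petal_eq x y C : C \in L -> x \notin B -> y \notin B -> x != c -> y != c ->
  x \in C -> y \in C -> petal x = petal y.
Proof.
move=> CL xB yB xc yc xC yC.
have [ltx bxL xbx] := petalP xB; have [lty byL yby] := petalP yB.
have CBL : C \in B :: L by rewrite inE CL orbT.
have bx : block x = C by apply: (@meet _ _ x); rewrite // inE bxL orbT.
have by_ : block y = C by apply: (@meet _ _ y); rewrite // inE byL orbT.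
apply/eqP; rewrite eqn_leq; apply/andP; split; rewrite leqNgt; apply/negP.
  by move=> /(before_find B); rewrite -/(block y) by_ xC.
by move=> /(before_find B); rewrite -/(block x) bx yC.
Qed.

Let label_lt x : label x < n.
Proof.
case: (labelP x) => [[_ ->]|[_ _ /andP[_ ?] _]|[_ xB _ _ [i i2 [_ ->]]]]; try lia.
by have [ltx _ _] := petalP xB; lia.
Qed.

Let index_enum_inj x y (A : {set T}) : x \in A -> y \in A ->
  index x (enum A) = index y (enum A) -> x = y.
Proof.
move=> xA yA eqi; rewrite -(nth_index x (s := enum A) (x := x)) ?mem_enum //.
by rewrite eqi nth_index ?mem_enum.
Qed.

Let label_inj : injective label.
Proof.
move=> x y; case: (labelP x) => [[-> ->]|[xc xB xm xE]|[xc xB bxL xbx [i i2 [iE ->]]]];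
  case: (labelP y) =>
    [[-> ->]|[yc yB ym yE]|[yc yB byL yby [i' i'2 [iE' ->]]]] //; try lia.
- move=> eq_l; have : index x (enum (B :\ c)) = index y (enum (B :\ c)) by lia.
  by apply: index_enum_inj; rewrite !inE ?xc ?yc.
- move=> eq_l; have eq_p : petal x = petal y by lia.
  have eq_i : i = i' by lia.
  move: iE' yby; rewrite /block -eq_p -/(block x) -eq_i iE => iE' yb.
  by apply: (index_enum_inj (A := block x :\ c)); rewrite // !inE ?xc ?yc.
Qed.

Lemma star_iso : graph_iso e (extremal_rel n k).
Proof.
exists (fun x => Ordinal (label_lt x)); split.
  apply: inj_card_bij; first by move=> x y [/label_inj].
  by rewrite card_ord cardT.
have sym_e x y : e x y = e y x.
  apply/edgeP/edgeP => -[neq_xy [C CL /andP[xC yC]]].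
    by split; rewrite 1?eq_sym //; exists C; rewrite ?yC.
  by split; rewrite 1?eq_sym //; exists C; rewrite ?yC.
have inE' x y C : C \in B :: L -> x \in C -> y \in C -> e x y = (x != y).
  move=> CL xC yC; apply/edgeP/idP => [[]|neq_xy] //.
  by split=> //; exists C; rewrite ?xC.
have adj_c y : e c y = (c != y).
  have [C CL yC] := cover y; exact: (inE' _ _ C CL (center CL) yC).
have cross x y : x \in B -> x != c -> y \notin B -> e x y = false.
  move=> xB xc yB; apply/edgeP => -[_ [C CL /andP[xC yC]]].
  by rewrite (meet CL (mem_head _ _) xC xB xc) (negPf yB) in yC.
move=> x y; rewrite /extremal_rel -val_eqE /= -mE (inj_eq label_inj).
have := labelP x; have := labelP y.
move=> [[-> ->]|[yc yB /andP[y0 ym] _]|[yc yB byL yby [i' i'2 [iE' yE]]]].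
- by move=> _; rewrite eqxx orbT andbT sym_e adj_c eq_sym.
- move=> [[-> ->]|[xc xB /andP[x0 xm] _]|[xc xB bxL xbx [i i2 [iE xE]]]].
  + by rewrite eqxx andbT adj_c.
  + by rewrite xm ym /= !orbT andbT (inE' _ _ B) ?mem_head.
  + rewrite sym_e cross // xE; apply/negbTE/nandP; right; lia.
- move=> [[-> ->]|[xc xB /andP[x0 xm] _]|[xc xB bxL xbx [i i2 [iE xE]]]].
  + by rewrite eqxx andbT adj_c.
  + rewrite cross // yE; apply/negbTE/nandP; right; lia.
(* For vertices outside [B] the label minus [m + 1] is twice the petal plus 0 or 1, so halving
   recovers the petal. *)
have -> : [|| label x == 0, label y == 0, (label x <= m) && (label y <= m)
    | [&& m < label x, m < label y & (label x - m - 1) %/ 2 == (label y - m - 1) %/ 2]]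
  = (petal x == petal y).
  by rewrite xE yE; apply/idP/idP; lia.
have bxBL : block x \in B :: L by rewrite inE bxL orbT.
have [eq_p|neq_p] := eqVneq (petal x) (petal y).
  rewrite andbT; apply/esym/(inE' _ _ (block x)) => //.
  by rewrite /block eq_p.
rewrite andbF; apply/esym/negbTE/edgeP => -[neq_xy [C]]; rewrite inE => /orP[/eqP->|CL].
  by rewrite (negPf xB).
move=> /andP[xC yC]; case/eqP: neq_p; exact: (petal_eq CL).
Qed.
End StarIso.

Local Open Scope ring_scope.

(** * The demand of a branch *)

Section Weights.
Variables (R : realFieldType) (w : R).

(** Each of [b] triangles contributes 2 / (w - 2). The second summand is the increment (e + 2) / (w
    - 2 - e) - 2 / (w - 2) caused by enlarging one triangle by [e] vertices. *)
Definition demand (b e : nat) : R :=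
  b%:R * (2 / (w - 2)) + w / (w - 2) * (e%:R / (w - 2 - e%:R)).

Lemma demand0 : demand 0 0 = 0.
Proof. by rewrite /demand !mul0r mulr0 addr0. Qed.

Lemma demand_ge0 b e : e%:R < w - 2 -> 0 <= demand b e.
Proof.
move=> lt_e; have e0 : 0 <= e%:R :> R by exact: ler0n.
have b0 : 0 <= b%:R :> R by exact: ler0n.
by rewrite addr_ge0 ?mulr_ge0 ?invr_ge0 //; lra.
Qed.

Lemma demand_gt0 b e : e%:R < w - 2 -> (0 < b)%N -> 0 < demand b e.
Proof.
move=> lt_e b0; have e0 : 0 <= e%:R :> R by exact: ler0n.
have {}b0 : 0 < b%:R :> R by rewrite ltr0n.
rewrite ltr_wpDr ?mulr_gt0 ?invr_gt0 //; first by rewrite !mulr_ge0 ?invr_ge0 //; lra.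
lra.
Qed.

(** With s = e + 2 non-root vertices of weight 0, the value t = s / (w - s) is the one for which
    root weight w - 1 - t makes the sum of inverses exactly 1. *)
Lemma demand1 e : e%:R < w - 2 ->
  demand 1 e = e.+2%:R / (w - e.+2%:R).
Proof.
move=> lt_e; have e0 : 0 <= e%:R :> R by exact: ler0n.
rewrite /demand -addn2 natrD; field; apply/andP; split; apply/eqP; lra.
Qed.

(** The part in [b] is linear, and e / (w - 2 - e) is convex and vanishes at 0. The gap is displayed
    as an explicit fraction, zero only if [e1] or [e2] is. *)
Lemma demand_superadd b1 e1 b2 e2 : (e1 + e2)%:R < w - 2 ->
  demand b1 e1 + demand b2 e2 <= demand (b1 + b2) (e1 + e2)
    ?= iff ((e1 == 0%N) || (e2 == 0%N)).
Proof.
move=> lt_e; rewrite natrD in lt_e.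
have e10 : 0 <= e1%:R :> R by exact: ler0n.
have e20 : 0 <= e2%:R :> R by exact: ler0n.
pose W := w - 2; have wE : w = W + 2 by rewrite /W; ring.
rewrite -/W in lt_e *.
have -> : demand (b1 + b2) (e1 + e2) = demand b1 e1 + demand b2 e2 +
   w / W * (e1%:R * e2%:R * (2 * W - e1%:R - e2%:R) /
     ((W - e1%:R) * (W - e2%:R) * (W - e1%:R - e2%:R))).
  rewrite /demand -/W !natrD; field; apply/and4P.
  by split; apply/eqP; lra.
have c0 : 0 < w / W by rewrite divr_gt0 //; lra.
have d0 : 0 < (W - e1%:R) * (W - e2%:R) * (W - e1%:R - e2%:R).
  by rewrite !mulr_gt0 //; lra.
have n0 : 0 < 2 * W - e1%:R - e2%:R by lra.
apply/leifP; case: ifP => [/orP[]/eqP-> |/norP[] h1 h2].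
- by rewrite !mul0r mulr0 addr0.
- by rewrite mulr0 !mul0r mulr0 addr0.
rewrite ltrDl mulr_gt0 // divr_gt0 //.
by rewrite !mulr_gt0 // ltr0n lt0n ?h1 ?h2.
Qed.

Lemma le_demand b1 e1 b2 e2 : (b1 <= b2)%N -> (e1 <= e2)%N -> e2%:R < w - 2 ->
  demand b1 e1 <= demand b2 e2.
Proof.
move=> lb le lt_e.
have := demand_superadd b1 (b2 - b1) (e1 := e1) (e2 := (e2 - e1)%N).
rewrite !subnKC // => /(_ lt_e) [le_d _]; apply: le_trans le_d.
rewrite lerDl demand_ge0 //; apply: le_lt_trans lt_e.
by rewrite ler_nat leq_subr.
Qed.

Lemma demand_sum (T : finType) (A : {pred T}) (b e : T -> nat) :
  (\sum_(v in A) e v)%:R < w - 2 ->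
  \sum_(v in A) demand (b v) (e v) <=
    demand (\sum_(v in A) b v) (\sum_(v in A) e v).
Proof.
move=> lt_e.
(* The size condition moves into the induction predicate so that partial sums inherit it. *)
suff: (\sum_(v in A) e v)%:R < w - 2 -> \sum_(v in A) demand (b v) (e v) <=
    demand (\sum_(v in A) b v) (\sum_(v in A) e v) by apply.
apply: (big_ind3 (fun x y z => z%:R < w - 2 -> x <= demand y z)) => //.
  by rewrite demand0.
move=> x1 y1 z1 x2 y2 z2 h1 h2 lt12.
have /h1 {}h1 : z1%:R < w - 2.
  by apply: le_lt_trans lt12; rewrite ler_nat leq_addr.
have /h2 {}h2 : z2%:R < w - 2.
  by apply: le_lt_trans lt12; rewrite ler_nat leq_addl.
by apply: le_trans (lerD h1 h2) _; rewrite demand_superadd.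
Qed.

(* Trading two excess vertices for one more triangle strictly lowers the
   demand; this compares graphs with the same number of vertices. *)
Lemma demand_trade b e j : (e + 2 * j)%:R < w - 2 -> (0 < j)%N ->
  demand (b + j) e < demand b (e + 2 * j).
Proof.
move=> lt_e j0.
(* By superadditivity it is enough to compare [demand 0 (2 * j)] with the contribution of [j]
   triangles. *)
have [le_d _] := demand_superadd b 0 lt_e; rewrite addn0 in le_d.
apply: lt_le_trans le_d.
rewrite /demand natrD; rewrite natrD natrM in lt_e.
have e0 : 0 <= e%:R :> R by exact: ler0n.
have {}j0 : 0 < j%:R :> R by rewrite ltr0n.
rewrite natrM mul0r add0r -subr_gt0.
set W := w - 2 in lt_e *.
set J := j%:R in lt_e j0 *.
rewrite [X in 0 < X](_ : _ = 2 * J * (2 * J + 2) / (W * (W - 2 * J))).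
  by rewrite divr_gt0 ?mulr_gt0 //; lra.
have -> : w = W + 2 by rewrite /W; ring.
field; apply/and3P; split; apply/eqP; lra.
Qed.

(** * Weights on a single clique *)

Section Clique.
Variables (T : finType) (B : {set T}).

(** By convexity 1 / (w - t) lies below its chord over [0, S], S being the sum of the weights.
    Summing the chords gives s / w + 1 / (w - S), and the hypothesis says 1 / (w - S) <= 1 - s / w.
    In case of equality every weight is 0 or S, so at most one is nonzero. *)
Lemma sum_inv_le1 (s : nat) (q : T -> R) :
    #|B| = s.+1 -> s%:R < w -> (forall v, v \in B -> 0 <= q v) ->
    \sum_(v in B) q v + s%:R / (w - s%:R) <= w - 1 ->
  [/\ forall v, v \in B -> q v < w,
      \sum_(v in B) (w - q v)^-1 <= 1
    & \sum_(v in B) (w - q v)^-1 = 1 ->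
      \sum_(v in B) q v + s%:R / (w - s%:R) = w - 1 /\
      forall u v, u \in B -> v \in B -> u != v -> q u = 0 \/ q v = 0].
Proof.
move=> cardB lt_s q0; set S := \sum_(v in B) q v => le_S.
have s0 : 0 <= s%:R :> R by exact: ler0n.
have S0 : 0 <= S by exact: sumr_ge0.
have p0 : 0 < w / (w - s%:R).
  rewrite divr_gt0 ?subr_gt0 //; apply: lt_le_trans (_ : 1 <= w) => //.
  have: 0 <= s%:R / (w - s%:R) by rewrite divr_ge0 // subr_ge0 ltW.
  by lra.
have pE : w / (w - s%:R) = 1 + s%:R / (w - s%:R) by field; apply/eqP; lra.
have wS : w / (w - s%:R) <= w - S by rewrite pE; lra.
have wS0 : 0 < w - S by apply: lt_le_trans wS.
have w0 : 0 < w by lra.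
have qS v : v \in B -> q v <= S.
  move=> vB; rewrite /S (bigD1 v) //= lerDl sumr_ge0 // => u /andP[uB _].
  exact: q0.
(* The slope is written as 1 / (w (w - S)), which makes sense for S = 0 as well. *)
have chord v : v \in B ->
    (w - q v)^-1 <= w^-1 + q v / (w * (w - S)) ?= iff (q v == 0) || (q v == S).
  move=> vB; have := q0 v vB; have := qS v vB => qv1 qv0.
  have -> : w^-1 + q v / (w * (w - S)) =
     (w - q v)^-1 + q v * (S - q v) / (w * (w - S) * (w - q v)).
    by field; apply/and3P; split; apply/eqP; lra.
  have d0 : 0 < w * (w - S) * (w - q v) by rewrite !mulr_gt0 //; lra.
  apply/leifP; case: ifP => [/orP[]/eqP-> |/norP[] h1 h2].
  - by rewrite !mul0r addr0.
  - by rewrite subrr mulr0 !mul0r addr0.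
  rewrite ltrDl divr_gt0 // mulr_gt0 // lt_neqAle ?subr_ge0 ?qv1 ?qv0 ?andbT.
    by rewrite eq_sym h1.
  by rewrite eq_sym subr_eq0 eq_sym h2.
have := leif_sum chord.
have -> : \sum_(v in B) (w^-1 + q v / (w * (w - S))) = s%:R / w + (w - S)^-1.
  rewrite big_split /= sumr_const cardB -mulr_suml -/S -[w^-1 *+ _]mulr_natr.
  rewrite -[s.+1%:R]natr1.
  by field; apply/andP; split; apply/eqP; lra.
move=> [sum_le sum_eq].
have invS : (w - S)^-1 <= (w - s%:R) / w.
  by rewrite -invf_div lef_pV2 // ?posrE ?invr_gt0.
have one : s%:R / w + (w - s%:R) / w = 1 by field; apply/eqP; lra.
split=> [v vB|| tight].
- by have := qS v vB; lra.
- lra.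
have eS : (w - S)^-1 = (w - s%:R) / w by lra.
split.
  have : w - S = w / (w - s%:R) by rewrite -[w - S]invrK eS invf_div.
  by rewrite pE; lra.
have all_eq : \sum_(v in B) (w - q v)^-1 == s%:R / w + (w - S)^-1.
  by apply/eqP; lra.
rewrite sum_eq in all_eq; move/forallP: all_eq => all_eq.
move=> u v uB vB neq_uv.
have {}all_eq z : z \in B -> q z = 0 \/ q z = S.
  by move=> zB; have := all_eq z; rewrite zB /= => /orP[]/eqP->; [left|right].
case: (all_eq u uB) => [|qu]; first by left.
case: (all_eq v vB) => [|qv]; first by right.
left; have: q u + q v <= S.
  rewrite /S (bigD1 u) //= (bigD1 v) /=; last by rewrite vB eq_sym.
  rewrite addrA lerDl sumr_ge0 // => z /andP[/andP[zB _] _]; exact: q0.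
by have := q0 u uB; lra.
Qed.

(** Cauchy-Schwarz as a weighted sum of squares of x v - S / (w - q v), which equals the sum of (w -
    q v) x v ^ 2 minus S ^ 2 (2 - H). Since H <= 1, equality with S nonzero forces H = 1. *)
Lemma clique_form_le (q x : T -> R) :
    (forall v, v \in B -> q v < w) -> \sum_(v in B) (w - q v)^-1 <= 1 ->
  (\sum_(v in B) x v) ^+ 2 - \sum_(v in B) x v ^+ 2
     <= \sum_(v in B) (w - 1 - q v) * x v ^+ 2
  /\ ((\sum_(v in B) x v) ^+ 2 - \sum_(v in B) x v ^+ 2
     = \sum_(v in B) (w - 1 - q v) * x v ^+ 2 ->
      \sum_(v in B) x v != 0 -> \sum_(v in B) (w - q v)^-1 = 1).
Proof.
move=> qw; set H := \sum_(v in B) _; set S := \sum_(v in B) x v => H1.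
have -> : \sum_(v in B) (w - 1 - q v) * x v ^+ 2 =
    \sum_(v in B) (w - q v) * x v ^+ 2 - \sum_(v in B) x v ^+ 2.
  by rewrite -sumrB; apply: eq_bigr => v _; ring.
have sq : 0 <= \sum_(v in B) (w - q v) * (x v - S / (w - q v)) ^+ 2.
  by apply: sumr_ge0 => v vB; rewrite mulr_ge0 ?sqr_ge0 // subr_ge0 ltW ?qw.
have sqE : \sum_(v in B) (w - q v) * (x v - S / (w - q v)) ^+ 2 =
    \sum_(v in B) (w - q v) * x v ^+ 2 - S ^+ 2 * (2 - H).
  rewrite mulrBr opprB [_ * 2](_ : _ = \sum_(v in B) 2 * S * x v); last first.
    by rewrite -mulr_sumr -/S; ring.
  rewrite /H mulr_sumr addrC -sumrN -!big_split /= [LHS]big_mkcond [RHS]big_mkcond.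
  apply: eq_bigr => v _; case: ifP => // vB.
  by field; have := qw v vB => ?; apply/eqP; lra.
have S2 : 0 <= S ^+ 2 by exact: sqr_ge0.
have S2H : 0 <= S ^+ 2 * (1 - H) by rewrite mulr_ge0 // subr_ge0.
rewrite sqE in sq; split; first by lra.
move=> eqn S0; have: S ^+ 2 * (1 - H) = 0 by lra.
by move/eqP; rewrite mulf_eq0 expf_eq0 (negPf S0) /= subr_eq0 => /eqP.
Qed.
End Clique.
End Weights.

(** * Quadratic forms of tree-like families of cliques *)

Section HypertreeForm.
Variables (R : realFieldType) (w : R) (T : finType).

Definition clique_form (x : T -> R) (B : {set T}) : R :=
  (\sum_(v in B) x v) ^+ 2 - \sum_(v in B) x v ^+ 2.

(** [b v] and [e v] are the number of blocks and the total excess of the branch hanging at [v]. The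
    induction hypothesis concerns [U :|: B]; the form of [B] is then added, and the branches beyond
    [B] are moved to its attaching vertex [p]. *)
Lemma hypertree_form (U : {set T}) (L : seq {set T}) :
    tree_seq U L -> all (fun B : {set T} => 2 < #|B|)%N L ->
  exists b e : T -> nat,
  [/\ (\sum_(v in U) b v)%N = size L, (\sum_(v in U) e v)%N = excess L,
      forall v C, v \in U -> C \in L -> v \in C -> (0 < b v)%N
    & (excess L)%:R < w - 2 -> demand w (size L) (excess L) <= w - 1 ->
      forall x, \sum_(B <- L) clique_form x B <=
        \sum_(v in U) demand w (b v) (e v) * x v ^+ 2 +
        (w - 1) * \sum_(v | v \notin U) x v ^+ 2].
Proof.
elim: L U => [|B L IHL] U /=.
  move=> _ _; exists (fun=> 0%N), (fun=> 0%N); split=> //.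
  - by rewrite big1.
  - by rewrite big1 // /excess big_nil.
  move=> _; rewrite /excess big_nil demand0 => w1 x.
  rewrite big_nil big1 => [|v _]; last by rewrite mul0r.
  by rewrite add0r mulr_ge0 // sumr_ge0 // => v _; exact: sqr_ge0.
move=> /andP[/cards1P[p BUp] treeL] /andP[B3 L3].
have [b [e [sum_b sum_e b_gt0 formL]]] := IHL _ treeL L3.
have pBU : p \in B :&: U by rewrite BUp set11.
have /andP[pB pU] : (p \in B) && (p \in U) by rewrite -in_setI.
pose D := B :\: U.
have pD : p \notin D by rewrite inE pU.
have BE : B = p |: D by rewrite /D -BUp setID.
have cardB : #|B| = #|D|.+1 by rewrite BE cardsU1 pD.
have setUI : (U :|: B) :&: U = U by exact: setUK.
have DE : (U :|: B) :\: U = D by rewrite setDUl setDv set0U.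
(* The branch that starts with [B]: the block itself and everything hanging at its far vertices
   [D]. *)
pose bB := (1 + \sum_(v in D) b v)%N.
pose eB := ((#|B| - 3) + \sum_(v in D) e v)%N.
pose b' v := (b v + (v == p) * bB)%N.
pose e' v := (e v + (v == p) * eB)%N.
have sumU (f : T -> nat) n :
    (\sum_(v in U) (f v + (v == p) * n) = \sum_(v in U) f v + n)%N.
  rewrite big_split /=; congr addn.
  rewrite (bigD1 p) //= eqxx mul1n big1 ?addn0 // => v /andP[_ /negPf->].
  by rewrite mul0n.
have excessE : excess (B :: L) = ((#|B| - 3) + excess L)%N.
  by rewrite /excess big_cons.
have sumUB (f : T -> nat) :
    (\sum_(v in U :|: B) f v = \sum_(v in U) f v + \sum_(v in D) f v)%N.
  by rewrite (big_setID U) /= setUI DE.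
have sum_b2 := sumUB b; have sum_e2 := sumUB e.
exists b', e'; split.
- by rewrite sumU /bB -sum_b sum_b2 addnCA add1n.
- by rewrite sumU /eB excessE -sum_e sum_e2 addnCA.
- move=> v C vU; rewrite inE /b' => /orP[/eqP-> vB|CL vC].
    have -> : v = p by apply/set1P; rewrite -BUp inE vB.
    by rewrite eqxx mul1n /bB addnCA.
  by rewrite ltn_addr // (b_gt0 v C) // inE vU.
move=> lt_w le_w1 x; set lam := w - 1.
have lt_eB : eB%:R < w - 2.
  apply: le_lt_trans lt_w; rewrite ler_nat excessE /eB leq_add2l -sum_e sum_e2.
  by rewrite leq_addl.
have QB_le : demand w bB eB <= lam.
  apply: le_trans le_w1; apply: le_demand => //.
    by rewrite /bB add1n ltnS -sum_b sum_b2 leq_addl.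
  by rewrite excessE /eB leq_add2l -sum_e sum_e2 leq_addl.
have le_eD v : v \in D -> (e v <= eB)%N.
  by move=> vD; rewrite /eB (bigD1 v) //= addnCA leq_addr.
have lt_e v : v \in D -> (e v)%:R < w - 2.
  by move=> vD; apply: le_lt_trans lt_eB; rewrite ler_nat le_eD.
(* At a far vertex [lam - q v] completes the demand of the branch there to [lam]; at [p] it is the
   demand of the branch starting with [B]. *)
pose q v := if v == p then lam - demand w bB eB else demand w (b v) (e v).
have qD v : v \in D -> q v = demand w (b v) (e v).
  by rewrite /q; case: eqP => // ->; rewrite (negPf pD).
have qp : q p = lam - demand w bB eB by rewrite /q eqxx.
have sumq : \sum_(v in B) q v =
    lam - demand w bB eB + \sum_(v in D) demand w (b v) (e v).
  by rewrite BE big_setU1 //= qp; congr (_ + _); apply: eq_bigr.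
have q0 v : v \in B -> 0 <= q v.
  rewrite BE !inE => /orP[/eqP->|/andP[vU vB]]; first by rewrite qp subr_ge0.
  have vD : v \in D by rewrite inE vU.
  by rewrite qD // demand_ge0 // lt_e.
have B3s : #|D| = (#|B| - 3).+2.
  by move: B3; rewrite cardB; case: #|D| => [|[|d]] // _; rewrite !subSS subn0.
have lt_s : #|D|%:R < w.
  have : (#|B| - 3)%:R < w - 2.
    by apply: le_lt_trans lt_eB; rewrite ler_nat leq_addr.
  by rewrite B3s -[_.+2%:R]natr1 -natr1; lra.
(* This provides the hypothesis of [sum_inv_le1]: [B] alone and the branches beyond it demand no
   more than their union. *)
have sumqD : \sum_(v in D) demand w (b v) (e v) + #|D|%:R / (w - #|D|%:R)
    <= demand w bB eB.
  rewrite B3s -demand1; last first.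
    by apply: le_lt_trans lt_eB; rewrite ler_nat leq_addr.
  rewrite addrC; apply: le_trans (_ : demand w 1 (#|B| - 3) +
     demand w (\sum_(v in D) b v) (\sum_(v in D) e v) <= _).
    rewrite lerD2l; apply: demand_sum.
    by apply: le_lt_trans lt_eB; rewrite ler_nat leq_addl.
  exact: demand_superadd.
have [| qw inv1 _] := sum_inv_le1 cardB lt_s q0.
  by rewrite sumq; move: sumqD; rewrite /lam; lra.
have [form_le _] := clique_form_le x qw inv1.
have lt_wL : (excess L)%:R < w - 2.
  by apply: le_lt_trans lt_w; rewrite ler_nat excessE leq_addl.
have le_wL : demand w (size L) (excess L) <= lam.
  apply: le_trans le_w1; apply: le_demand => //; by rewrite ?excessE ?leq_addl.
have {}formL := formL lt_wL le_wL x.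
(* Superadditivity merges the branch starting with [B] with those already hanging at [p]. *)
have demand_p : demand w (b p) (e p) + demand w bB eB <= demand w (b' p) (e' p).
  rewrite /b' /e' eqxx !mul1n; apply: demand_superadd.
  apply: le_lt_trans lt_w; rewrite ler_nat excessE -sum_e sum_e2 /eB.
  by rewrite (bigD1 p pU) /= addnCA leq_add2l -addnA leq_add2l leq_addl.
have sumU' : \sum_(v in U) demand w (b v) (e v) * x v ^+ 2 +
    demand w bB eB * x p ^+ 2 <= \sum_(v in U) demand w (b' v) (e' v) * x v ^+ 2.
  rewrite (bigD1 p pU) /= [leRHS](bigD1 p pU) /=.
  rewrite [X in _ <= _ + X](eq_bigr (fun v => demand w (b v) (e v) * x v ^+ 2)).
    have := ler_wpM2r (sqr_ge0 (x p)) demand_p; lra.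
  by move=> v /andP[_ /negPf vp]; rewrite /b' /e' vp !mul0n !addn0.
have sumC : \sum_(v | v \notin U) x v ^+ 2 =
    \sum_(v in D) x v ^+ 2 + \sum_(v | v \notin U :|: B) x v ^+ 2.
  rewrite (bigID (mem D)) /=; congr (_ + _); apply: eq_bigl => v.
    by rewrite inE andbA andbb.
  by rewrite !inE; case: (v \in U).
have sumD : \sum_(v in B) (w - 1 - q v) * x v ^+ 2 = demand w bB eB * x p ^+ 2 +
    lam * \sum_(v in D) x v ^+ 2 - \sum_(v in D) demand w (b v) (e v) * x v ^+ 2.
  rewrite BE big_setU1 //= qp mulr_sumr.
  rewrite (eq_bigr (fun v => lam * x v ^+ 2 - demand w (b v) (e v) * x v ^+ 2)).
    by rewrite sumrB addrA; congr (_ + _ - _); rewrite /lam; ring.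
  by move=> v vD; rewrite qD // mulrBl.
move: formL; rewrite (big_setID U) /= setUI DE => formL.
rewrite big_cons sumC mulrDr; move: form_le; rewrite sumD /clique_form.
by move: formL sumU'; rewrite /lam /clique_form; lra.
Qed.
End HypertreeForm.

(** * Spectral radius and positive vectors *)

(** The order of [algC] is partial, so each comparison rests on norms being real. *)
Lemma bigmax_norm (s : seq algC) (M := \big[Num.max/0]_(z <- s) `|z|) :
  [/\ 0 <= M, {in s, forall z, `|z| <= M} & M = 0 \/ exists2 z, z \in s & M = `|z|].
Proof.
rewrite /M {M}; elim: s => [|a s [M0 Mge Matt]].
  by rewrite big_nil; split=> //; left.
rewrite big_cons; set M := \big[_/_]_(_ <- _) _ in M0 Mge Matt *.
have [leM|ltM] := real_leP (normr_real a) (ger0_real M0).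
  split=> // [z|]; first by rewrite inE => /orP[/eqP->|/Mge].
  case: Matt => [|[z zs Mz]]; [by left | right].
  by exists z => //; rewrite inE zs orbT.
split=> [|z|]; [exact: normr_ge0 | | by right; exists a; rewrite ?mem_head].
rewrite inE => /orP[/eqP->|/Mge leM] //; exact: le_trans leM (ltW ltM).
Qed.

Lemma spectral_radius_spec (m : nat) (A : 'M[algC]_m) :
  [/\ 0 <= spectral_radius A,
      forall z, eigenvalue A z -> `|z| <= spectral_radius A
    & spectral_radius A = 0 \/
      exists2 z, eigenvalue A z & spectral_radius A = `|z|].
Proof.
have [rho0 rho_ge rho_att] :=
  bigmax_norm (sval (closed_field_poly_normal (char_poly A))).
have spectrumE z :
    (z \in sval (closed_field_poly_normal (char_poly A))) = eigenvalue A z.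
  case: closed_field_poly_normal => s /= sP.
  rewrite eigenvalue_root_char sP (monicP (char_poly_monic A)) scale1r.
  by rewrite root_prod_XsubC.
split=> // [z|]; first by rewrite -spectrumE; apply: rho_ge.
case: rho_att => [|[z]]; first by left.
by rewrite spectrumE; right; exists z.
Qed.

Section Radius.
Variables (T : finType) (e : rel T).

Lemma adj_eigenvalueP (z : algC) :
  reflect (exists2 f : T -> algC, exists v, f v != 0 &
             forall v, \sum_u (e u v)%:R * f u = z * f v)
          (eigenvalue (adj_matrix e) z).
Proof.
apply: (iffP eigenvalueP) => [[r rA r0]|[f [v fv] fE]].
  exists (fun v => r 0 (enum_rank v)).
    by have /rV0Pn[i ri] := r0; exists (enum_val i); rewrite enum_valK.
  move=> v; move/rowP/(_ (enum_rank v)): rA; rewrite !mxE => <-.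
  rewrite (reindex_onto (@enum_val T predT) (@enum_rank T)) /=; last first.
    by move=> u _; rewrite enum_rankK.
  apply: eq_big => [i|i _]; first by rewrite enum_valK eqxx.
  by rewrite !mxE enum_rankK enum_valK mulrC.
exists (\row_i f (enum_val i)).
  apply/rowP => j; rewrite !mxE -fE.
  rewrite [RHS](reindex_onto (@enum_val T predT) (@enum_rank T)) /=; last first.
    by move=> u _; rewrite enum_rankK.
  apply: eq_big => [i|i _]; first by rewrite enum_valK eqxx.
  by rewrite !mxE mulrC.
apply: contra fv => /eqP/rowP/(_ (enum_rank v)).
by rewrite !mxE enum_rankK => ->.
Qed.

(** The moduli of an eigenvector for an eigenvalue of maximal modulus work, by the triangle
    inequality. They are taken in [algR], an ordered field. *)
Lemma radius_subeigenvector : (0 < #|T|)%N ->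
  exists (r : algR) (x : T -> algR),
    [/\ algRval r = graph_spectral_radius e, forall v, 0 <= x v, exists v, 0 < x v
      & forall v, r * x v <= \sum_u (e u v)%:R * x u].
Proof.
move=> T0; have [_ _ [rho0E|[z]]] := spectral_radius_spec (adj_matrix e).
  (* When the radius is 0 the constant vector serves. *)
  exists 0, (fun=> 1); split=> //.
    by case/card_gt0P: T0 => v _; exists v.
  by move=> v; rewrite mul0r sumr_ge0 // => u _; rewrite mulr_ge0 ?ler0n.
move=> /adj_eigenvalueP[f [v0 fv0] fE] zE.
pose x v := in_algR (normr_real (f v)).
exists (in_algR (normr_real z)), x; split.
- exact: esym zE.
- by move=> v; exact: normr_ge0.
- exists v0; change (0 < `|f v0|); by rewrite normr_gt0.
move=> v.
change (algRval (in_algR (normr_real z) * x v) <= algRval (\sum_u (e u v)%:R * x u)).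
rewrite rmorphM rmorph_sum /= -normrM -fE.
apply: le_trans (ler_norm_sum _ _ _) _; apply: ler_sum => u _.
by rewrite normrM normr_nat -(rmorph_nat algRval).
Qed.

(** Perron-Frobenius comparison: at a vertex maximizing [x v / y v], the inequality for the
    subeigenvector [x] yields r <= lam. Conversely [lam] is itself an eigenvalue. *)
Lemma radius_positive_eigenvector (lam : algR) (y : T -> algR) :
    (0 < #|T|)%N -> (forall v, 0 < y v) ->
    (forall v, \sum_u (e u v)%:R * y u = lam * y v) ->
  graph_spectral_radius e = algRval lam.
Proof.
move=> T0 y0 yE; have /card_gt0P[v0 _] := T0.
have lam0 : 0 <= lam.
  rewrite -(pmulr_lge0 _ (y0 v0)) -yE sumr_ge0 // => u _.
  by rewrite mulr_ge0 ?ler0n // ltW.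
apply/eqP; rewrite eq_le; apply/andP; split; last first.
  have [_ rho_ge _] := spectral_radius_spec (adj_matrix e).
  rewrite -[leLHS]ger0_norm //; apply: rho_ge; apply/adj_eigenvalueP.
  exists (algRval \o y).
    exists v0; apply/eqP => /eqP; apply/negP.
    by have := y0 v0; rewrite lt_neqAle eq_sym => /andP[].
  move=> v; have := congr1 algRval (yE v).
  rewrite (rmorph_sum algRval) => sumE.
  change (\sum_u (e u v)%:R * algRval (y u) = algRval (lam * y v)); rewrite -sumE.
  by apply: eq_bigr => u _; rewrite /= (rmorph_nat algRval).
have [r [x [<- x0 [v1 xv1] xE]]] := radius_subeigenvector T0.
change (r <= lam).
case: (@Order.TotalTheory.arg_maxP _ algR T v1 xpredT (fun v => x v / y v)) =>
  // v _ vmax.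
have xle u : x u <= x v / y v * y u.
  by rewrite -ler_pdivrMr //; apply: vmax.
have xv : 0 < x v.
  have := lt_le_trans xv1 (xle v1).
  by rewrite pmulr_lgt0 // pmulr_lgt0 // invr_gt0.
rewrite -(ler_pM2r xv); apply: le_trans (xE v) _.
apply: le_trans (_ : \sum_u (e u v)%:R * (x v / y v * y u) <= _).
  by apply: ler_sum => u _; rewrite ler_wpM2l ?ler0n.
rewrite (eq_bigr (fun u => x v / y v * ((e u v)%:R * y u))); last by move=> u _; ring.
rewrite -mulr_sumr yE [leLHS](_ : _ = lam * x v) //.
by field; rewrite gt_eqF.
Qed.
End Radius.

Section Subeigenvector.
Variables (R : realFieldType) (T : finType) (e : rel T).

(* Replacing [x] by [x + A x] preserves [r x <= A x] and spreads the support. *)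
Lemma subeigenvector_gt0 (r : R) (x : T -> R) : connected_graph e ->
    (forall v, 0 <= x v) -> (exists v, 0 < x v) ->
    (forall v, r * x v <= \sum_u (e u v)%:R * x u) ->
  exists2 y : T -> R, forall v, 0 < y v &
    forall v, r * y v <= \sum_u (e u v)%:R * y u.
Proof.
move=> con_e; have [k] := ubnP #|[set v | x v == 0]|.
elim: k x => // k IHk x ltk x0 [a xa] xA.
have [/forallP pos|] := boolP [forall v, 0 < x v]; first by exists x.
move=> npos.
(* Without an edge from the support to a zero, connectedness would spread positivity from [a]
   everywhere. *)
have [u [v euv /andP[xu xv]]] : exists u, exists2 v, e u v & (0 < x u) && (x v == 0).
  have [/existsP[u /existsP[v /and3P[]]]|/existsPn no_edge] :=
      boolP [exists u, exists v, [&& e u v, 0 < x u & x v == 0]].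
    by move=> euv xu xv; exists u, v => //; rewrite xu.
  case/negP: npos; apply/forallP => z.
  apply: (@connected_closed _ e (fun v => 0 < x v) a z con_e _ xa) => u v euv xu.
  have /existsPn/(_ v) := no_edge u; rewrite euv xu /= => xv.
  by rewrite lt_neqAle eq_sym xv x0.
pose y v := x v + \sum_u (e u v)%:R * x u.
have A0 z : 0 <= \sum_u (e u z)%:R * x u.
  by apply: sumr_ge0 => w _; rewrite mulr_ge0 ?ler0n.
have xy z : x z <= y z by rewrite lerDl.
apply: (IHk y).
- rewrite -ltnS; apply: leq_trans ltk; rewrite ltnS; apply: proper_card.
  apply/properP; split.
    apply/subsetP => z; rewrite !inE => /eqP yz.
    by rewrite eq_le x0 -yz xy.
  exists v; rewrite !inE //.
  rewrite gt_eqF // /y (bigD1 u) //= euv mul1r.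
  have : 0 <= \sum_(i | i != u) (e i v)%:R * x i.
    by apply: sumr_ge0 => w _; rewrite mulr_ge0 ?ler0n.
  by rewrite (eqP xv); lra.
- by move=> z; apply: le_trans (x0 z) (xy z).
- by exists a; apply: lt_le_trans xa (xy a).
move=> z; rewrite /y mulrDr.
rewrite [leRHS](eq_bigr (fun u => (e u z)%:R * x u +
    (e u z)%:R * \sum_w (e w u)%:R * x w)); last by move=> w _; rewrite mulrDr.
rewrite big_split /=; apply: lerD (xA z) _.
rewrite mulr_sumr; apply: ler_sum => w _.
by rewrite mulrCA ler_wpM2l ?ler0n.
Qed.

(** Each edge lies in some member of [L], so its nonnegative term occurs at least once on the
    right. *)
Lemma edge_form_le (L : seq {set T}) (x : T -> R) :
    irreflexive e -> (forall u v, e u v -> exists2 B, B \in L & (u \in B) && (v \in B)) ->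
    (forall v, 0 <= x v) ->
  \sum_v x v * (\sum_u (e u v)%:R * x u) <= \sum_(B <- L) clique_form x B.
Proof.
move=> irr_e covL x0.
have formE B : clique_form x B =
    \sum_v \sum_u ([&& u \in B, v \in B & u != v])%:R * (x u * x v).
  rewrite /clique_form expr2 mulr_suml [RHS](bigID (mem B)) /= [X in _ = _ + X]big1.
    rewrite addr0 -sumrB; apply: eq_bigr => v vB.
    rewrite (bigD1 v) //= [RHS](bigD1 v) //= eqxx /= !andbF mul0r add0r.
    rewrite mulrDr addrC expr2 addKr mulr_sumr [LHS]big_mkcond [RHS]big_mkcond /=.
    apply: eq_bigr => u _ /=.
    rewrite vB; case: (u \in B); case: (u == v); rewrite ?mul0r ?mul1r //=.
    by rewrite mulrC.
  move=> v /negPf vB; rewrite big1 // => u _.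
  by rewrite vB andbF mul0r.
rewrite (eq_bigr _ (fun B _ => formE B)) exchange_big /=.
apply: ler_sum => v _; rewrite exchange_big mulr_sumr /=.
apply: ler_sum => u _; rewrite -mulr_suml.
rewrite [leLHS](_ : _ = (e u v)%:R * (x u * x v)); last by ring.
apply: ler_wpM2r; first by rewrite mulr_ge0.
have [euv|_] := boolP (e u v); last by apply: sumr_ge0 => B _; exact: ler0n.
have [B BL /andP[uB vB]] := covL _ _ euv.
have neq_uv : u != v by apply: contraTneq euv => ->; rewrite irr_e.
rewrite (big_rem B) //= uB vB neq_uv lerDl.
by apply: sumr_ge0 => C _; exact: ler0n.
Qed.
End Subeigenvector.

(** * The bound obtained from one root block, and its equality case *)

Section Bound.
Variables (R : realFieldType) (w : R) (T : finType) (e : rel T).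

(** With the demand of the branch at [v] as weight of [v] in [B], the forms of [B] and of [L] add up
    to at most [w - 1] times the squared norm. If r = w - 1, the clique inequality of [B] and the
    superadditivity between [B] and [L] are tight. *)
Lemma hypertree_bound (B : {set T}) (L : seq {set T}) (r : R) (x : T -> R) :
    irreflexive e -> tree_seq B L -> all (fun C : {set T} => 2 < #|C|)%N (B :: L) ->
    (forall u v, e u v -> exists2 C, C \in B :: L & (u \in C) && (v \in C)) ->
    (excess (B :: L))%:R < w - 2 ->
    demand w (size (B :: L)) (excess (B :: L)) <= w - 1 ->
    (forall v, 0 < x v) -> (forall v, r * x v <= \sum_u (e u v)%:R * x u) ->
  r <= w - 1 /\
  (r = w - 1 ->
    [/\ demand w (size (B :: L)) (excess (B :: L)) = w - 1,
        (#|B| - 3 = 0)%N \/ excess L = 0%N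
      & forall u v C D, u \in B -> v \in B -> C \in L -> D \in L ->
          u \in C -> v \in D -> u = v]).
Proof.
move=> irr_e treeL /andP[B3 L3] covL lt_w le_w1 x0 xA; set lam := w - 1.
have [b [c [sum_b sum_c b_gt0 formL]]] := hypertree_form w treeL L3.
have excessE : excess (B :: L) = ((#|B| - 3) + excess L)%N.
  by rewrite /excess big_cons.
have lt_wL : (excess L)%:R < w - 2.
  by apply: le_lt_trans lt_w; rewrite ler_nat excessE leq_addl.
have lt_wB : (#|B| - 3)%:R < w - 2.
  by apply: le_lt_trans lt_w; rewrite ler_nat excessE leq_addr.
have superL : demand w (size L) (excess L) + demand w 1 (#|B| - 3) <=
    demand w (size (B :: L)) (excess (B :: L)) ?= iff
    ((#|B| - 3 == 0)%N || (excess L == 0)%N).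
  rewrite addrC excessE /= -add1n; apply: demand_superadd.
  by rewrite -excessE.
have demB0 : 0 <= demand w 1 (#|B| - 3) by apply: demand_ge0.
have {}formL := formL lt_wL _ x.
pose q v := demand w (b v) (c v).
have lt_c v : v \in B -> (c v)%:R < w - 2.
  move=> vB; apply: le_lt_trans lt_wL; rewrite ler_nat -sum_c (bigD1 v) //=.
  exact: leq_addr.
have q0 v : v \in B -> 0 <= q v by move=> vB; apply/demand_ge0/lt_c.
have sumq_le : \sum_(v in B) q v <= demand w (size L) (excess L).
  by rewrite -sum_b -sum_c; apply: demand_sum; rewrite sum_c.
have BE : #|B| = (#|B| - 3).+3 by rewrite -addn3 subnK.
have lt_s : (#|B| - 3).+2%:R < w.
  by rewrite -[_.+2%:R]natr1 -natr1; lra.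
have [|qw inv1 tight1] := sum_inv_le1 BE lt_s q0.
  by rewrite -demand1 //; case: superL; lra.
have [form_le form_eq] := clique_form_le x qw inv1.
have lam_le : demand w (size L) (excess L) <= lam by case: superL; rewrite /lam; lra.
have {}formL := formL lam_le.
have edge_le := edge_form_le irr_e covL (fun v => ltW (x0 v)).
have r_le : r * \sum_v x v ^+ 2 <= \sum_v x v * (\sum_u (e u v)%:R * x u).
  rewrite mulr_sumr; apply: ler_sum => v _.
  rewrite expr2 mulrA [leLHS]mulrC; apply: ler_wpM2l => //; exact: ltW.
have sumC : \sum_v x v ^+ 2 = \sum_(v in B) x v ^+ 2 + \sum_(v | v \notin B) x v ^+ 2.
  exact: bigID.
have sumB : \sum_(v in B) (w - 1 - q v) * x v ^+ 2 =
    lam * \sum_(v in B) x v ^+ 2 - \sum_(v in B) q v * x v ^+ 2.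
  by rewrite mulr_sumr -sumrB; apply: eq_bigr => v _; rewrite mulrBl.
rewrite big_cons in edge_le; rewrite sumB in form_le form_eq.
have [v0 v0B] : exists v, v \in B by apply/card_gt0P; rewrite BE.
have x2 : 0 < \sum_v x v ^+ 2.
  rewrite (bigD1 v0) //=; apply: ltr_wpDr; last by rewrite exprn_gt0.
  by apply: sumr_ge0 => v _; exact: sqr_ge0.
have r_le' : r * \sum_v x v ^+ 2 <= lam * \sum_v x v ^+ 2.
  rewrite [in leRHS]sumC mulrDr; move: edge_le form_le formL r_le.
  by rewrite /clique_form /lam /q; lra.
split; first by rewrite -(ler_pM2r x2).
move=> rE; rewrite rE -/lam sumC mulrDr in r_le.
have tight : (\sum_(v in B) x v) ^+ 2 - \sum_(v in B) x v ^+ 2 =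
  lam * (\sum_(v in B) x v ^+ 2) - \sum_(v in B) q v * x v ^+ 2.
  apply/eqP; rewrite eq_le form_le /=; move: edge_le formL r_le.
  by rewrite /clique_form /lam /q; lra.
have sumx : \sum_(v in B) x v != 0.
  rewrite gt_eqF // (bigD1 v0) //=; apply: ltr_wpDr => //.
  by apply: sumr_ge0 => v _; exact: ltW.
have [sumqE q_eq] := tight1 (form_eq tight sumx).
rewrite -demand1 // in sumqE.
have demE : demand w (size (B :: L)) (excess (B :: L)) = w - 1.
  by apply/eqP; rewrite eq_le le_w1 /=; case: superL; lra.
split=> //.
  have [_ eqE] := superL; have : demand w (size L) (excess L) + demand w 1 (#|B| - 3)
     == demand w (size (B :: L)) (excess (B :: L)).
    by apply/eqP; rewrite demE; case: superL; lra.
  by rewrite eqE => /orP[]/eqP->; [left|right].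
(* A vertex of [B] in a further block has positive demand, and tightness allows only one such
   vertex. *)
move=> u v C D uB vB CL DL uC vD; apply/eqP; apply: contraT => neq_uv.
have qu : 0 < q u by apply: demand_gt0; [exact: lt_c | exact: (b_gt0 u C)].
have qv : 0 < q v by apply: demand_gt0; [exact: lt_c | exact: (b_gt0 v D)].
by case: (q_eq u v uB vB neq_uv) => qE; [move: qu | move: qv]; rewrite qE ltxx.
Qed.
End Bound.

(** * The extremal graph *)

Section Extremal.

(* [P] is the equation cleared of denominators.  The bracket starts at [m + 1],
   the value belonging to the clique on [m + 1] vertices alone. *)
Lemma demand_fixpoint (R : rcfType) (b M : nat) : (0 < b)%N ->
  exists2 w : R, M.+2%:R < w & demand w b M = w - 1.
Proof.
move=> b0; pose m : R := M.+2%:R; pose b' : R := b%:R.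
have b1 : 1 <= b' by rewrite ler1n.
have m2 : 2 <= m by rewrite ler_nat.
pose P : {poly R} := ('X - 1%:P) * ('X - 2%:P) * ('X - m%:P)
   - (2 * (b' - 1))%:P * ('X - m%:P) - m%:P * ('X - 2%:P).
have PE w : P.[w] = (w - 1) * (w - 2) * (w - m) - 2 * (b' - 1) * (w - m) - m * (w - 2).
  by rewrite /P !hornerE.
(* At the left end the value is -2 (b' - 1) <= 0, at the right end it is nonnegative. A root here
   exceeds [m], so no denominator vanishes. *)
have [||w /andP[w_ge _] /rootP] := @poly_ivt R P (m + 1) (m + 2 * b').
- lra.
- rewrite !PE; apply/andP; split.
    by rewrite [leLHS](_ : _ = - (2 * (b' - 1))); [lra | ring].
  rewrite [leRHS](_ : _ = m * (m + 2 * b' - 2) * (2 * b' - 1) +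
     2 * b' * ((2 * b' - 1) * (m + 2 * b' - 2) - 2 * (b' - 1))); last by ring.
  have h1 : 0 <= m * (m + 2 * b' - 2) * (2 * b' - 1) by rewrite !mulr_ge0 //; lra.
  have h2 : 0 <= (2 * b' - 1) * (m + 2 * b' - 3) by rewrite mulr_ge0 //; lra.
  have h3 : 0 <= 2 * b' * ((2 * b' - 1) * (m + 2 * b' - 2) - 2 * (b' - 1)).
    by rewrite mulr_ge0 //; lra.
  exact: addr_ge0.
rewrite PE => Pw; exists w; first by rewrite -/m; lra.
have ME : M%:R = m - 2 by rewrite /m -[M.+2%:R]natr1 -natr1; ring.
rewrite /demand ME -/b'.
have -> : w - 1 = b' * (2 / (w - 2)) + w / (w - 2) * ((m - 2) / (w - 2 - (m - 2))) +
  ((w - 1) * (w - 2) * (w - m) - 2 * (b' - 1) * (w - m) - m * (w - 2)) /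
  ((w - 2) * (w - m)).
  by field; apply/andP; split; apply/eqP; lra.
by rewrite Pw mul0r addr0.
Qed.

Variables (n k : nat).
Hypotheses (k_ge : (n./2 + 1 <= k)%N) (k_le : (k <= n - 1)%N).
Let m := (2 * k - n + 1)%N.

(** The entries are 1 at the centre, [a] on the rest of the large clique and [t] on the triangles.
    The equations off the centre read a (w - m) = 1 and t (w - 2) = 1; the one at the centre is the
    demand equation. *)
Lemma extremal_eigenvector (R : realFieldType) (w : R) : m%:R < w ->
    demand w (n - k) (m - 2) = w - 1 ->
  exists2 y : 'I_n -> R, forall v, 0 < y v &
    forall v, \sum_u (extremal_rel n k u v)%:R * y u = (w - 1) * y v.
Proof.
move=> ltw wE.
have [m2 nE] : (2 <= m)%N /\ n = (m + 1 + 2 * (n - k - 1))%N.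
  by rewrite /m; split; move: k_ge k_le; lia.
set p := (n - k - 1)%N in nE.
have m2R : 2 <= m%:R :> R by rewrite ler_nat.
pose a : R := (w - m%:R)^-1; pose t : R := (w - 2)^-1.
pose Y i : R := if i is 0%N then 1 else if (i <= m)%N then a else t.
have a0 : 0 < a by rewrite invr_gt0; lra.
have t0 : 0 < t by rewrite invr_gt0; lra.
have aE : a * (w - m%:R) = 1 by rewrite mulVf //; apply/eqP; lra.
have tE : t * (w - 2) = 1 by rewrite mulVf //; apply/eqP; lra.
have cE : m%:R * a + p%:R * 2 * t = w - 1.
  rewrite -wE /demand (_ : (n - k)%N = (p + 1)%N); last by rewrite /p; move: k_le; lia.
  rewrite natrD (natrB _ m2) /a /t; field; apply/andP; split; apply/eqP; lra.
have Ypos i : 0 < Y i by rewrite /Y; case: i => // i; case: ifP.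
have n0 : (0 < n)%N by lia.
have sum_big : \sum_(u < n | (u <= m)%N) Y u = 1 + m%:R * a.
  transitivity (\sum_(u < m.+1) Y u); first by rewrite (big_ord_widen n Y) //; lia.
  rewrite big_ord_recl /=; congr (_ + _).
  rewrite (eq_bigr (fun=> a)) => [|i _]; last by rewrite /Y /= /bump /= add1n ltn_ord.
  by rewrite sumr_const card_ord mulr_natl.
have sum_all : \sum_(u < n) Y u = 1 + m%:R * a + p%:R * 2 * t.
  rewrite (bigID (fun u : 'I_n => (u <= m)%N)) /= sum_big; congr (_ + _).
  rewrite (eq_bigr (fun=> t)); last by case=> [[|i] ?] //= /negPf; rewrite /Y => ->.
  rewrite sumr_const (_ : #|_| = (p * 2)%N); last first.
    have := cardC (fun u : 'I_n => (u <= m)%N); rewrite card_ord.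
    have -> : #|(fun u : 'I_n => (u <= m)%N)| = m.+1.
      rewrite -[RHS]card_ord -!sum1_card (big_ord_widen n (fun=> 1%N)) //; lia.
    rewrite (eq_card (B := fun u : 'I_n => ~~ (u <= m)%N)) //.
    by lia.
  by rewrite -[t *+ _]mulr_natl natrM.
have sum_delta (z : 'I_n) : \sum_(u < n) (u == z)%:R * Y u = Y z.
  rewrite (bigD1 z) //= eqxx mul1r big1 ?addr0 // => u /negPf->.
  by rewrite mul0r.
exists (fun u : 'I_n => Y u) => //.
move=> v; have [v0|v0] := posnP (val v).
  rewrite (eq_bigr (fun u : 'I_n => Y u - (u == v)%:R * Y u)); last first.
    move=> u _; rewrite /extremal_rel v0 /= orbT andbT.
    by case: (u == v); rewrite ?mul0r ?mul1r ?subrr ?subr0.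
  rewrite sumrB sum_all sum_delta.
  rewrite v0 /= -cE; ring.
have [vm|vm] := leqP v m.
  rewrite (eq_bigr (fun u : 'I_n =>
    (if (u <= m)%N then Y u else 0) - (u == v)%:R * Y u)); last first.
    move=> u _; rewrite /extremal_rel -/m vm /= (gtn_eqF v0) orFb andbT.
    rewrite (ltnNge m v) vm /= andbF orbF.
    case: eqP => [->|_] /=; first by rewrite vm mul0r mul1r subrr.
    case: (leqP u m) => um; first by rewrite orbT mul1r mul0r subr0.
    by rewrite (gtn_eqF (leq_ltn_trans (leq0n _) um)) !mul0r subr0.
  rewrite sumrB -big_mkcond sum_big sum_delta.
  have Ya i : (0 < i <= m)%N -> Y i = a by case: i => // i im; rewrite /Y; case: ifP im.
  rewrite Ya; last by apply/andP.
  by have := aE; rewrite mulrBr; lra.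
pose j := (v - m - 1)%N.
have ltj : (j < 2 * p)%N by have := ltn_ord v; rewrite /j; lia.
(* Offsets pair up as 0 and 1, 2 and 3, and so on; [j'] is the partner of [j] in its triangle. *)
pose j' := if odd j then j.-1 else j.+1.
have ltj' : (m + 1 + j' < n)%N by rewrite /j'; case: ifP; lia.
pose v' := Ordinal ltj'.
pose z := Ordinal n0.
have relE (u : 'I_n) : extremal_rel n k u v = (u == z) || (u == v').
  rewrite /extremal_rel -/m -!val_eqE /= vm (gtn_eqF v0) orFb.
  rewrite leqNgt (leqNgt v) vm /= andbF orFb /= -/j.
  have vE : nat_of_ord v = (m + 1 + j)%N by rewrite /j; lia.
  rewrite vE /j'; clearbody j.
  by apply/idP/idP; case: ifP; lia.
rewrite (eq_bigr (fun u : 'I_n => (u == z)%:R * Y u + (u == v')%:R * Y u)); last first.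
  move=> u _; rewrite relE; case: (eqVneq u z) => [->|_] /=.
    by rewrite (_ : (z == v') = false) ?mul0r ?addr0 // -val_eqE /=; lia.
  by rewrite mul0r add0r.
rewrite big_split /= !sum_delta.
have Yt i : (m < i)%N -> Y i = t by case: i => // i; rewrite /Y ltnNge => /negPf->.
have -> : Y z = 1 by [].
rewrite (Yt v') ?(Yt v) //; last by rewrite /=; lia.
by have := tE; rewrite mulrBr; lra.
Qed.

End Extremal.

(** * Equality *)

Section Star.
Variables (T : finType) (e : rel T).
Hypotheses (sym_e : symmetric e) (tree_e : clique_tree e) (big_e : blocks_ge3 e).

Lemma block_gt2 B : is_block e B -> (2 < #|B|)%N.
Proof. by move: big_e => /forallP/(_ B)/implyP. Qed.

(* The last hypothesis says that every block contains at most one cut vertex. *)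
Lemma star_center (B C : {set T}) (c : T) :
    is_block e B -> is_block e C -> B != C -> c \in B -> c \in C ->
    (forall X Y Z u v, is_block e X -> is_block e Y -> is_block e Z ->
       Y != X -> Z != X -> u \in X -> v \in X -> u \in Y -> v \in Z -> u = v) ->
  forall D, is_block e D -> c \in D.
Proof.
move=> blockB blockC neq_BC cB cC cut D blockD.
have con_e : connected_graph e by case/andP: tree_e.
(* The vertices sharing a block with [c] are closed under adjacency: a block through [c] has its
   only cut vertex there, so edges at its other vertices stay inside it. *)
have near v : exists2 X, is_block e X & (c \in X) && (v \in X).
  suff /existsP[X /and3P[? ? ?]] :
      [exists X, [&& is_block e X, c \in X & v \in X]].
    by exists X => //; apply/andP.
  apply: (@connected_closed _ e
    (fun v => [exists X, [&& is_block e X, c \in X & v \in X]]) c v con_e);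
    last by apply/existsP; exists B; rewrite blockB cB.
  move=> x y exy /existsP[X /and3P[blockX cX xX]]; apply/existsP.
  have [Y blockY /andP[xY yY]] := edge_in_block sym_e exy.
  have [xc|xc] := eqVneq x c; first by exists Y; rewrite blockY yY -xc xY.
  have [eq_XY|neq_XY] := eqVneq X Y.
    by exists Y; rewrite blockY yY -eq_XY cX.
  have [Z blockZ /andP[neq_ZX cZ]] : exists2 Z, is_block e Z & (Z != X) && (c \in Z).
    have [eq_BX|neq_BX] := eqVneq B X; last by exists B; rewrite ?neq_BX.
    by exists C; rewrite // -eq_BX eq_sym neq_BC.
  rewrite eq_sym in neq_XY.
  by rewrite (cut X Y Z x c blockX blockY blockZ neq_XY neq_ZX xX cX xY cZ) eqxx in xc.
(* Otherwise two vertices of [D] would lie in blocks through [c], all different from [D]. *)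
apply: contraT => cD.
have /card_gt1P[u [v [uD vD]]] : (1 < #|D|)%N by rewrite ltnW // block_gt2.
have [X blockX /andP[cX uX]] := near u.
have [Y blockY /andP[cY vY]] := near v.
have XD : X != D by apply: contraNneq cD => <-.
have YD : Y != D by apply: contraNneq cD => <-.
by rewrite (cut D X Y u v blockD blockX blockY XD YD uD vD uX vY) eqxx.
Qed.
End Star.

Section Transport.
Variables (R : realFieldType) (T1 T2 : finType) (e1 : rel T1) (e2 : rel T2).

Lemma iso_eigenvector (f : T1 -> T2) (lam : R) (y : T2 -> R) :
    bijective f -> (forall x z, e2 (f x) (f z) = e1 x z) ->
    (forall v, \sum_u (e2 u v)%:R * y u = lam * y v) ->
  forall v, \sum_u (e1 u v)%:R * y (f u) = lam * y (f v).
Proof.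
move=> bij_f fE yE v; rewrite -yE [RHS](reindex f); last exact: onW_bij.
by apply: eq_bigr => u _; rewrite fE.
Qed.
End Transport.

(** * Comparison of a clique tree with the extremal graph *)

Theorem theorem3p3 (n k : nat) (T : finType) (e : rel T) :
  (n./2 + 1 <= k)%N -> (k <= n - 1)%N ->
  simple_graph e -> #|T| = n ->
  clique_tree e -> blocks_ge3 e -> zero_forcing_number e = k ->
  graph_spectral_radius e <= graph_spectral_radius (extremal_rel n k) /\
  (graph_spectral_radius e = graph_spectral_radius (extremal_rel n k)
     <-> graph_iso e (extremal_rel n k)).
Proof.
move=> k_ge k_le [sym_e irr_e] cardT tree_e big_e zfE.
have n_gt0 : (0 < n)%N by lia.
(* [M] is the total excess when there are exactly [n - k] blocks, and [M.+2] is the [m] of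
   [extremal_rel]. *)
pose M := (2 * k - n - 1)%N.
have [w ltw wE] : exists2 w : algR, M.+2%:R < w & demand w (n - k) M = w - 1.
  by apply: demand_fixpoint; lia.
have ltM : M%:R < w - 2 by move: ltw; rewrite -[M.+2%:R]natr1 -natr1; lra.
have mM : (2 * k - n + 1)%N = M.+2 by rewrite /M; lia.
have [y y0 yE] : exists2 y : 'I_n -> algR, forall v, 0 < y v &
    forall v, \sum_u (extremal_rel n k u v)%:R * y u = (w - 1) * y v.
  by apply: extremal_eigenvector; rewrite ?mM // subn2.
have rhoH : graph_spectral_radius (extremal_rel n k) = algRval (w - 1).
  by apply: radius_positive_eigenvector y0 yE; rewrite card_ord.
have T_gt0 : (0 < #|T|)%N by rewrite cardT.
have con_e : connected_graph e by case/andP: tree_e.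
have [r [x0 [rE x0_ge x0_gt x0A]]] := radius_subeigenvector e T_gt0.
have [x x_gt xA] := subeigenvector_gt0 con_e x0_ge x0_gt x0A.
have gt2 := block_gt2 big_e.
(* Stated for every root block, because the equality case combines the conclusions for all of
   them. *)
have bound (B : {set T}) : is_block e B -> exists L,
    [/\ tree_seq B L, forall C, C \in B :: L -> is_block e C,
        forall C, is_block e C -> C \in B :: L
      & r <= w - 1 /\ (r = w - 1 ->
        [/\ (size L).+1 = (n - k)%N, ((#|B| - 3) + excess L)%N = M,
            (#|B| - 3 = 0)%N \/ excess L = 0%N
          & forall u v C D, u \in B -> v \in B -> C \in L -> D \in L ->
              u \in C -> v \in D -> u = v])].
  move=> blockB; have B0 : B != set0 by rewrite -card_gt0 ltnW // ltnW // gt2.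
  have [L [treeL blockL covL allL]] := block_order sym_e tree_e blockB B0.
  have blockBL C : C \in B :: L -> is_block e C.
    by rewrite inE => /orP[/eqP->|/blockL].
  have allBL C : is_block e C -> C \in B :: L.
    by move=> blockC; apply: allL => //; rewrite ltnW // gt2.
  exists L; split=> //.
  have excessE : excess (B :: L) = ((#|B| - 3) + excess L)%N.
    by rewrite /excess big_cons.
  have count : n = (1 + 2 * (size L).+1 + excess (B :: L))%N.
    have := tree_seq_card treeL covL; rewrite cardT excessE => <-.
    have -> : (\sum_(C <- L) (#|C| - 1) = 2 * size L + excess L)%N.
      rewrite /excess; elim: (L) blockL => [|C K IHK] blockK.
        by rewrite !big_nil.
      rewrite !big_cons IHK => [|D DK]; last by rewrite blockK // inE DK orbT.
      have := gt2 C (blockK C (mem_head _ _)); rewrite /=.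
      by move: #|C| (size K) (\sum_(_ <- K) _)%N => a b' c; clear; lia.
    have := gt2 B blockB; move: #|B| (size L) (excess L) => a b' c; clear; lia.
  have size_ge : (n - k <= (size L).+1)%N.
    have := zero_forcing_number_blocks sym_e tree_e.
    have : (#|[set C | is_block e C]| <= (size L).+1)%N.
      apply: leq_trans (card_size (B :: L)); apply/subset_leq_card/subsetP => C.
      by rewrite inE; apply: allBL.
    by rewrite cardT zfE; move: #|[set C | is_block e C]| (size L) => a b'; clear; lia.
  (* Surplus blocks: as [n] is fixed, each costs two units of excess, so [demand_trade] applies and
     equality forces j = 0. *)
  pose j := ((size L).+1 - (n - k))%N.
  have sizeE : (size L).+1 = (n - k + j)%N by rewrite /j subnKC.
  have ME : M = (excess (B :: L) + 2 * j)%N.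
    rewrite /M; move: count sizeE; move: (size L) (excess (B :: L)) j => a b' c.
    by move: k_ge k_le; clear; lia.
  have lt_w : (excess (B :: L))%:R < w - 2.
    by apply: le_lt_trans ltM; rewrite ler_nat ME leq_addr.
  have dem_le : demand w (size (B :: L)) (excess (B :: L)) <= w - 1 ?= iff (j == 0)%N.
    rewrite /= sizeE -wE ME; apply/leifP; case: eqVneq => [->|j0].
      by rewrite muln0 !addn0.
    by apply: demand_trade; rewrite ?lt0n // -ME.
  have [||r_le r_eq] :=
    hypertree_bound (w := w) (r := r) irr_e treeL _ _ lt_w dem_le x_gt xA.
  - by apply/allP => C CL; rewrite gt2 // blockBL.
  - move=> u v euv; have [C blockC uvC] := edge_in_block sym_e euv.
    by exists C => //; apply: allBL.
  split=> // /r_eq[dem_eq ex0 cut]; have j0 : j = 0%N.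
    by apply/eqP; case: dem_le => _ <-; rewrite dem_eq.
  split=> //; first by rewrite sizeE j0 addn0.
  by rewrite -excessE ME j0 muln0 addn0.
have [B0 blockB0] : exists B, is_block e B.
  have [|B blockB _] := @nonseparable_sub_block _ e set0; last by exists B.
  by rewrite /nonseparable connected_in0; apply/forall_inP => v; rewrite inE.
(* With a largest block as root, both alternatives for the excess leave only triangles in [L]. *)
have [B blockB maxB] := arg_maxnP (fun B : {set T} => #|B|) blockB0.
have [L [treeL blockL allL [r_le r_eq]]] := bound B blockB.
rewrite rhoH -rE; split; first exact: r_le.
split=> [/val_inj rw|[f [bij_f fE]]]; last first.
  rewrite rE; apply: (@radius_positive_eigenvector _ _ _ (y \o f)) => //.
    by move=> v; exact: y0.
  exact: (iso_eigenvector bij_f fE yE).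
have [sizeL exL exBL _] := r_eq rw.
have exL0 : excess L = 0%N.
  case: exBL => // B3; rewrite /excess big1_seq // => C /andP[_ CL].
  have := maxB C (blockL C _); rewrite inE CL orbT => /(_ isT).
  by move: B3; move: #|B| #|C| => a b; clear; lia.
have cardL C : C \in L -> #|C| = 3.
  move=> CL; have := gt2 C (blockL C _); rewrite inE CL orbT => /(_ isT).
  move: exL0; rewrite /excess (big_rem C) //= => /eqP; rewrite addn_eq0 => /andP[].
  by move: #|C| => a; clear; lia.
(* With a single block any vertex serves; otherwise the vertex where the first block of [L] meets
   [B]. *)
have [c cP] : exists c, forall D, is_block e D -> c \in D.
  case: L treeL blockL allL {r_eq sizeL exL exBL exL0 cardL} => [|C L] treeL blockL allL.
    have /card_gt0P[c cB] : (0 < #|B|)%N by rewrite ltnW // ltnW // gt2.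
    by exists c => D /allL; rewrite inE => /eqP->.
  move: treeL => /= /andP[/cards1P[c BC] _].
  have /andP[cC cB] : (c \in C) && (c \in B) by rewrite -in_setI BC set11.
  have blockC : is_block e C by apply: blockL; rewrite !inE eqxx orbT.
  have neq_BC : B != C.
    apply/eqP => eq_BC; have := gt2 B blockB.
    by move: BC; rewrite -eq_BC setIid => ->; rewrite cards1.
  exists c; apply: (star_center sym_e tree_e big_e blockB blockC neq_BC cB cC).
  move=> X Y Z u v blockX blockY blockZ YX ZX uX vX uY vZ.
  have [K [_ _ allK [_ /(_ rw)[_ _ _ cut]]]] := bound X blockX.
  have inK D : is_block e D -> D != X -> D \in K.
    by move=> blockD DX; have := allK D blockD; rewrite inE (negPf DX).
  exact: (cut u v Y Z uX vX (inK Y blockY YX) (inK Z blockZ ZX) uY vZ).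
have blockcov v : exists2 C, is_block e C & v \in C.
  have [->|vc] := eqVneq v c; first by exists B; rewrite ?cP.
  have [|C blockC vC] := @nonseparable_sub_block _ e [set v].
    rewrite /nonseparable connected_in1; apply/forall_inP => u /set1P->.
    by rewrite setDv connected_in0.
  by exists C => //; rewrite (subsetP vC) // set11.
apply: (@star_iso T e n k M.+2 c B L) => //.
- by move: sizeL k_ge k_le; rewrite /M; move: (size L) => s; clear; lia.
- by move: exL (gt2 B blockB); rewrite exL0 /M; move: #|B| => a; clear; lia.
- by move=> C CL; apply/cP/blockL.
- move=> C D v CL DL vC vD vc.
  have blockC := blockL C CL; have blockD := blockL D DL.
  exact: (block_meet sym_e blockC blockD vC vD (cP C blockC) (cP D blockD) vc).
- move=> u v; apply: (iffP idP) => [euv|[neq_uv [C CL /andP[uC vC]]]].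
    split; first by apply: contraTneq euv => ->; rewrite irr_e.
    by have [C blockC uvC] := edge_in_block sym_e euv; exists C; rewrite // allL.
  exact: (block_clique tree_e (blockL C CL) uC vC neq_uv).
by move=> v; have [C blockC vC] := blockcov v; exists C; rewrite // allL.
Qed.
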